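(* Let $(A_{-1}\oplus A_0;\rho,l_1,l_2,l_3)$ be a quadratic Lie 2-algebroid over a manifold $M$ with bilinear form $\mathcal S$ on $A_{-1}\oplus\ker\rho$, and let $(\sigma,\gamma)$ be a splitting with associated $R_\gamma:\wedge^2TM\to\ker\rho$ and $I_\gamma:\wedge^3TM\to A_{-1}$. Define $\mathcal S(R_\gamma,I_\gamma)\in\Omega^5(M)$ by $$\mathcal S(R_\gamma,I_\gamma)(X_1,\dots,X_5)=\frac1{12}\sum_{\tau\in S_5}\mathrm{sgn}(\tau)\,\mathcal S\big(R_\gamma(X_{\tau(1)},X_{\tau(2)}),I_\gamma(X_{\tau(3)},X_{\tau(4)},X_{\tau(5)})\big).$$ Then the 5-form $\mathcal S(R_\gamma,I_\gamma)$ is closed, i.e. $d\,\mathcal S(R_\gamma,I_\gamma)=0$, and its cohomology class $[\mathcal S(R_\gamma,I_\gamma)]\in H^5(M)$ does not depend on the choices of $\sigma$ and $\gamma$.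
   Context: A Lie 2-algebra $(V_{-1}\oplus V_0;l_1,l_2,l_3)$: linear $l_1:V_{-1}\to V_0$; bilinear $l_2$, skew-symmetric on $V_0$ with values in $V_0$, $l_2(x,m)=-l_2(m,x)\in V_{-1}$, zero on $V_{-1}\times V_{-1}$; totally skew-symmetric $l_3:V_0^3\to V_{-1}$; such that for $w,x,y,z\in V_0$, $m,n\in V_{-1}$: $l_1l_2(x,m)=l_2(x,l_1m)$; $l_2(l_1m,n)=l_2(m,l_1n)$; $l_1l_3(x,y,z)=l_2(x,l_2(y,z))-l_2(l_2(x,y),z)-l_2(y,l_2(x,z))$; $l_3(x,y,l_1m)=l_2(x,l_2(y,m))-l_2(l_2(x,y),m)-l_2(y,l_2(x,m))$; $l_2(w,l_3(x,y,z))-l_2(x,l_3(w,y,z))+l_2(y,l_3(w,x,z))+l_2(l_3(w,x,y),z)-l_3(l_2(w,x),y,z)-l_3(x,l_2(w,y),z)-l_3(x,y,l_2(w,z))+l_3(w,l_2(x,y),z)+l_3(w,y,l_2(x,z))-l_3(w,x,l_2(y,z))=0$. A Lie 2-algebroid over $M$: graded vector bundle $A_{-1}\oplus A_0$, bundle map $\rho:A_0\to TM$, brackets making $(\Gamma(A_{-1})\oplus\Gamma(A_0);l_1,l_2,l_3)$ a Lie 2-algebra, with $l_1,l_3$ $C^\infty(M)$-linear and $l_2(X^0,fY)=fl_2(X^0,Y)+\rho(X^0)(f)Y$ for $X^0\in\Gamma(A_0)$ and $Y$ a section of $A_0$ or $A_{-1}$. It is transitive if $\rho$ is surjective. A transitive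 Lie 2-algebroid is quadratic if there is a degree 1 nondegenerate graded symmetric bilinear form $\mathcal S$ on $A_{-1}\oplus\ker\rho$ (so $\mathcal S$ pairs $A_{-1}$ nondegenerately with $\ker\rho$, $\mathcal S(u,m)=\mathcal S(m,u)$, and vanishes on $A_{-1}\times A_{-1}$ and $\ker\rho\times\ker\rho$) with, for all $u,v\in\Gamma(\ker\rho)$, $e^0,e^0_1,e^0_2\in\Gamma(A_0)$, $m,p\in\Gamma(A_{-1})$: $\mathcal S(l_1(m),p)=\mathcal S(m,l_1(p))$; $\rho(e^0)\mathcal S(u,m)=\mathcal S(l_2(e^0,u),m)+\mathcal S(u,l_2(e^0,m))$; $\mathcal S(l_3(e^0_1,e^0_2,u),v)=-\mathcal S(l_3(e^0_1,e^0_2,v),u)$. A splitting $(\sigma,\gamma)$ is a bundle map $\sigma:TM\to A_0$ with $\rho\circ\sigma=\mathrm{id}$ and a bundle map $\gamma:\wedge^2TM\to A_{-1}$. It defines $\nabla^1_Xm=l_2(\sigma(X),m)$, $R(X,Y)=\sigma[X,Y]-l_2(\sigma(X),\sigma(Y))-l_1\gamma(X,Y)$, $I(X,Y,Z)=-d_{\nabla^1}\gamma(X,Y,Z)-l_3(\sigma(X),\sigma(Y),\sigma(Z))$, $R_\gamma=R+l_1\circ\gamma$, $I_\gamma=I+d_{\nabla^1}\gamma$, where $d_\nabla$ is the covariant exterior derivative $d_\nabla\theta(X_1,\dots,X_{k+1})=\sum_i(-1)^{i+1}\nabla_{X_i}\theta(\dots,\widehat{X_i},\dots)+\sum_{i<j}(-1)^{i+j}\theta([X_i,X_j],\dots,\widehat{X_i},\dots,\widehat{X_j},\dots)$.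 The class $[\mathcal S(R_\gamma,I_\gamma)]$ is called the first Pontryagin class. *)

(* Defs.v *)
From HB Require Import structures.
From mathcomp Require Import all_boot all_order all_fingroup all_algebra.
From mathcomp Require Import all_classical all_reals all_analysis.
From mathcomp Require Import ring.
Import numFieldNormedType.Exports.
Import Order.TTheory GRing.Theory Num.Theory.

Set Implicit Arguments.
Unset Strict Implicit.
Unset Printing Implicit Defensive.

Local Open Scope classical_set_scope.
Local Open Scope ring_scope.

Section EuclideanSmooth.
Variables (R : realType) (n : nat).
Implicit Types (U : set 'rV[R]_n) (f g : 'rV[R]_n -> R).

(* f is C^k on the open set U: for k > 0, all directional derivatives exist on
   U and are C^(k-1) there. *)
Fixpoint Ck (k : nat) U f : Prop :=
  (forall x, U x -> {for x, continuous f}) /\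
  if k is k'.+1 then
    forall v, (forall x, U x -> derivable f x v) /\ Ck k' U (fun x => 'D_v f x)
  else True.

Definition Csmooth U f : Prop := forall k, Ck k U f.

Lemma Ck_cont k U f : Ck k U f -> forall x, U x -> {for x, continuous f}.
Proof. by case: k => [|k] []. Qed.

Lemma CkW k U f : Ck k.+1 U f -> Ck k U f.
Proof.
elim: k f => [|k IH] f; first by case.
move=> [cf df]; split=> // v; have [dv Cv] := df v; split=> //; exact: IH.
Qed.

Lemma Ck_ext k U f g : open U -> {in U, f =1 g} -> Ck k U f -> Ck k U g.
Proof.
move=> oU; have nE f' g' x : {in U, f' =1 g'} -> U x -> \near x, f' x = g' x.
  move=> fg Ux; apply: filterS (open_nbhs_nbhs (conj oU Ux)) => y Uy.
  by apply: fg; rewrite inE.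
have cE f' g' x : {in U, f' =1 g'} -> U x ->
    {for x, continuous f'} -> {for x, continuous g'}.
  move=> fg Ux; have e : f' x = g' x by apply: fg; rewrite inE.
  rewrite /prop_for /continuous_at -e; apply: cvg_trans.
  exact: (near_eq_cvg (nE f' g' x fg Ux)).
elim: k f g => [|k IH] f g fg [cf df]; (split; first by
  move=> x Ux; apply: cE (fg) _ _ => //; exact: cf) => // v.
have [dv Cv] := df v; split=> [x Ux|].
  by apply: near_eq_derivable (dv x Ux); exact: nE.
by apply: IH Cv => x; rewrite inE => Ux; apply: near_eq_derive; exact: nE.
Qed.

Lemma Ck_cst k U (a : R) : open U -> Ck k U (fun=> a).
Proof.
move=> oU; elim: k a => [|k IH] a; (split; first by move=> x _; exact: cst_continuous) => // v.
split=> [x _|]; first exact: derivable_cst.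
by apply: (@Ck_ext k U (fun=> 0)) => // x _; rewrite derive_cst.
Qed.

Lemma Ck_add k U f g : open U -> Ck k U f -> Ck k U g -> Ck k U (fun x => f x + g x).
Proof.
move=> oU; elim: k f g => [|k IH] f g Cf Cg;
  (split; first by move=> x Ux; apply: continuousD; [exact: (Ck_cont Cf)|exact: (Ck_cont Cg)]) => // v.
have [df Df] := Cf.2 v; have [dg Dg] := Cg.2 v.
split=> [x Ux|]; first exact: derivableD (df x Ux) (dg x Ux).
apply: (Ck_ext oU _ (IH _ _ Df Dg)) => x; rewrite inE => Ux.
by rewrite [RHS](deriveD (df x Ux) (dg x Ux)).
Qed.

Lemma Ck_mul k U f g : open U -> Ck k U f -> Ck k U g -> Ck k U (fun x => f x * g x).
Proof.
move=> oU; elim: k f g => [|k IH] f g Cf Cg;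
  (split; first by move=> x Ux; apply: continuousM; [exact: (Ck_cont Cf)|exact: (Ck_cont Cg)]) => // v.
have [df Df] := Cf.2 v; have [dg Dg] := Cg.2 v.
split=> [x Ux|]; first exact: derivableM (df x Ux) (dg x Ux).
apply: (Ck_ext oU _ (Ck_add oU (IH _ _ (CkW Cf) Dg) (IH _ _ (CkW Cg) Df))) => x.
by rewrite inE => Ux; rewrite [RHS](deriveM (df x Ux) (dg x Ux)).
Qed.

End EuclideanSmooth.

(* Charts are homeomorphisms from an open subset of M onto an open subset of
   R^n; only the values of [cmap] on [cdom] and of [cinv] on the image of
   [cdom] matter. *)
Record chart (R : realType) (n : nat) (M : topologicalType) := Chart {
  cdom : set M;
  cmap : M -> 'rV[R]_n;
  cinv : 'rV[R]_n -> M;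
  cdom_open : open cdom;
  cimg_open : open (cmap @` cdom);
  cmapK : forall x, cdom x -> cinv (cmap x) = x;
  cmap_continuous : forall x, cdom x -> {for x, continuous cmap};
  cinv_continuous : forall y, (cmap @` cdom) y -> {for y, continuous cinv} }.

Arguments cdom_open {R n M} c.
Arguments cimg_open {R n M} c.

Record manifold (R : realType) (n : nat) := Manifold {
  mcarrier :> topologicalType;
  mhausdorff : hausdorff_space mcarrier;
  msecond_countable : second_countable (T := mcarrier);
  atlas : set (chart R n mcarrier);
  atlas_cover : forall x, exists2 c, atlas c & cdom c x;
  atlas_compat : forall c c', atlas c -> atlas c' -> forall k : 'I_n,
    Csmooth (cmap c @` (cdom c `&` cdom c')) (fun y => cmap c' (cinv c y) ord0 k) }.

Section SmoothFunctions.
Variables (R : realType) (n : nat) (M : manifold R n).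
Implicit Types (U : set M) (f g : M -> R).

Definition smooth_on U f : Prop := forall c, atlas (m := M) c ->
  Csmooth (cmap c @` (U `&` cdom c)) (fun y => f (cinv c y)).

Lemma cmap_img_open (c : chart R n M) U :
  open U -> open (cmap c @` (U `&` cdom c)).
Proof.
move=> oU.
have -> : cmap c @` (U `&` cdom c) = (cmap c @` cdom c) `&` (cinv c @^-1` U).
  apply/seteqP; split=> [_ [x [Ux cx] <-]|_ [[x cx <-] Ux]].
    by split; [exists x | rewrite /preimage/= cmapK].
  by exists x => //; split=> //; move: Ux; rewrite /preimage/= cmapK.
rewrite openE => y [cy Uy].
have ny : nbhs y (cmap c @` cdom c) by exact: open_nbhs_nbhs (conj (cimg_open c) cy).
have nU : nbhs (cinv c y) U by exact: open_nbhs_nbhs.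
exact: (filterI ny (cinv_continuous cy nU)).
Qed.

Lemma smooth_on_cst U (a : R) : open U -> smooth_on U (fun=> a).
Proof. by move=> oU c _ k; apply: Ck_cst; exact: cmap_img_open. Qed.

Lemma smooth_on_add U f g : open U ->
  smooth_on U f -> smooth_on U g -> smooth_on U (fun x => f x + g x).
Proof.
move=> oU sf sg c ac k.
by apply: Ck_add; [exact: cmap_img_open | exact: sf | exact: sg].
Qed.

Lemma smooth_on_mul U f g : open U ->
  smooth_on U f -> smooth_on U g -> smooth_on U (fun x => f x * g x).
Proof.
move=> oU sf sg c ac k.
by apply: Ck_mul; [exact: cmap_img_open | exact: sf | exact: sg].
Qed.

Lemma Ck_sub k (V W : set 'rV[R]_n) (f : 'rV[R]_n -> R) :
  V `<=` W -> Ck k W f -> Ck k V f.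
Proof.
move=> VW; elim: k f => [|k IH] f [cf df]; (split; first by
  move=> x /VW; exact: cf) => // v.
by have [dv Cv] := df v; split=> [x /VW|]; [exact: dv | exact: IH].
Qed.

Lemma smooth_onW U V f : U `<=` V -> smooth_on V f -> smooth_on U f.
Proof.
move=> UV sf c ac k; apply: Ck_sub (sf c ac k).
by apply: image_subset => x [Ux cx]; split=> //; exact: UV.
Qed.

Definition smooth_pred : {pred M -> R} := [pred f | `[< smooth_on setT f >]].

Lemma smooth_predP f : reflect (smooth_on setT f) (f \in smooth_pred).
Proof. exact: asboolP. Qed.

Lemma smooth_subring : subring_closed smooth_pred.
Proof.
have oT : open [set: M] by exact: openT.
split=> [|f g /smooth_predP sf /smooth_predP sg|f g /smooth_predP sf /smooth_predP sg];
  apply/smooth_predP.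
- exact: smooth_on_cst.
- have -> : f - g = fun x => f x + (-1) * g x.
    by apply/funext => x; rewrite mulN1r.
  by apply: smooth_on_add => //; apply: smooth_on_mul => //; exact: smooth_on_cst.
- exact: smooth_on_mul.
Qed.

HB.instance Definition _ :=
  GRing.isSubringClosed.Build (M -> R)%type smooth_pred smooth_subring.

Record smoothfun := SmoothFun {
  sfun :> M -> R;
  sfunP : sfun \in smooth_pred }.

HB.instance Definition _ := [isSub for sfun].
HB.instance Definition _ := [Choice of smoothfun by <:].
HB.instance Definition _ := GRing.SubChoice_isSubComPzRing.Build
  (M -> R)%type smooth_pred smoothfun smooth_subring.

Definition smooth_cst (a : R) : smoothfun :=
  SmoothFun (introT (smooth_predP _) (smooth_on_cst a (@openT M))).

Lemma smoothfun_ext (f g : smoothfun) : f =1 g -> f = g.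
Proof. by move=> fg; apply: val_inj => /=; exact: funext. Qed.

End SmoothFunctions.

Section TangentVectors.
Variables (R : realType) (n : nat) (M : manifold R n).

Definition derivation_at (x : M) : {pred smoothfun M -> R} := [pred D |
  `[< (forall (a : R) (f g : smoothfun M),
         D (smooth_cst M a * f + g) = a * D f + D g) /\
      (forall f g : smoothfun M, D (f * g) = D f * g x + f x * D g) >]].

Lemma derivation_at_submod x : submod_closed (derivation_at x).
Proof.
split=> [|a D D' /asboolP[lD LD] /asboolP[lD' LD']]; apply/asboolP.
  by split=> *; rewrite ?mulr0 ?mul0r ?addr0.
split=> [b f g|f g].
  by rewrite !fctE /= lD lD'; rewrite /GRing.scale /=; ring.
by rewrite !fctE /= LD LD'; rewrite /GRing.scale /=; ring.
Qed.

HB.instance Definition _ (x : M) :=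
  GRing.isSubmodClosed.Build R (smoothfun M -> R)%type (derivation_at x)
    (derivation_at_submod x).

(* The tangent space T_x M: derivations of C^oo(M) at x. *)
Record tangent (x : M) := Tangent {
  tfun :> smoothfun M -> R;
  tfunP : tfun \in derivation_at x }.

HB.instance Definition _ x := [isSub for @tfun x].
HB.instance Definition _ x := [Choice of tangent x by <:].
HB.instance Definition _ x := [SubChoice_isSubLmodule of tangent x by <:].

End TangentVectors.

(* A family of vector spaces over M with a C^oo(M)-module of distinguished
   global sections.  Vector bundles, the tangent bundle, the kernel of a bundle
   map and direct sums are all presented this way.  Since a fibrewise linear
   map between vector bundles is smooth iff it sends smooth global sections to
   smooth sections, this is all that is needed to speak of bundle maps. *)
Record vfamily (R : realType) (n : nat) (M : manifold R n) := Family {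
  fib :> M -> lmodType R;
  smooth_sec : (forall x, fib x) -> Prop;
  smooth_sec0 : smooth_sec (fun=> 0);
  smooth_secP : forall (f : smoothfun M) (s t : forall x, fib x),
    smooth_sec s -> smooth_sec t -> smooth_sec (fun x => f x *: s x + t x) }.

Section Sections.
Variables (R : realType) (n : nat) (M : manifold R n) (E : vfamily M).

Record section := Section_ {
  sec :> forall x, E x;
  secP : smooth_sec sec }.

HB.instance Definition _ := gen_eqMixin section.
HB.instance Definition _ := gen_choiceMixin section.

Lemma section_ext (s t : section) : (forall x, s x = t x) -> s = t.
Proof.
case: s t => s sP [t tP] /= st.
have {}st : s = t by apply: functional_extensionality_dep.
by subst t; rewrite (Prop_irrelevance sP tP).
Qed.

Lemma smooth_sec_ext (s t : forall x, E x) :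
  (forall x, s x = t x) -> smooth_sec s -> smooth_sec t.
Proof. by move=> st; have -> : s = t by apply: functional_extensionality_dep. Qed.

Lemma smooth_secD (s t : section) : smooth_sec (fun x => s x + t x).
Proof.
apply: smooth_sec_ext (smooth_secP 1 (secP s) (secP t)) => x.
by rewrite scale1r.
Qed.

Lemma smooth_secZ (f : smoothfun M) (s : section) :
  smooth_sec (fun x => f x *: s x).
Proof.
apply: smooth_sec_ext (smooth_secP f (secP s) (smooth_sec0 E)) => x.
by rewrite addr0.
Qed.

Lemma smooth_secN (s : section) : smooth_sec (fun x => - s x).
Proof.
apply: smooth_sec_ext (smooth_secZ (-1) s) => x.
by rewrite -[LHS]/((-1) *: _) scaleN1r.
Qed.

Definition sec0 := Section_ (smooth_sec0 E).
Definition secD s t := Section_ (smooth_secD s t).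
Definition secN s := Section_ (smooth_secN s).
Definition secZ f s := Section_ (smooth_secZ f s).

Fact secDA : associative secD.
Proof. by move=> s t u; apply: section_ext => x; exact: addrA. Qed.
Fact secDC : commutative secD.
Proof. by move=> s t; apply: section_ext => x; exact: addrC. Qed.
Fact sec0D : left_id sec0 secD.
Proof. by move=> s; apply: section_ext => x; exact: add0r. Qed.
Fact secND : left_inverse sec0 secN secD.
Proof. by move=> s; apply: section_ext => x; exact: addNr. Qed.

HB.instance Definition _ := GRing.isZmodule.Build section secDA secDC sec0D secND.

Fact secZA f g s : secZ f (secZ g s) = secZ (f * g) s.
Proof. by apply: section_ext => x; exact: scalerA. Qed.
Fact sec1Z : left_id 1 secZ.
Proof. by move=> s; apply: section_ext => x; exact: scale1r. Qed.
Fact secZDr : right_distributive secZ +%R.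
Proof. by move=> f s t; apply: section_ext => x; exact: scalerDr. Qed.
Fact secZDl s : {morph secZ^~ s : f g / f + g}.
Proof. by move=> f g; apply: section_ext => x; exact: scalerDl. Qed.

HB.instance Definition _ := GRing.Zmodule_isLmodule.Build (smoothfun M) section
  secZA sec1Z secZDr secZDl.

(* [section E] is a module over C^oo(M); this alias carries the restriction of
   scalars to R. *)
Definition rsection := section.

HB.instance Definition _ := GRing.Zmodule.on rsection.

Definition rsecZ (a : R) (s : rsection) : rsection := smooth_cst M a *: (s : section).

Fact rsecZA a b s : rsecZ a (rsecZ b s) = rsecZ (a * b) s.
Proof. by apply: section_ext => x; exact: scalerA. Qed.
Fact rsec1Z : left_id 1 rsecZ.
Proof. by move=> s; apply: section_ext => x; exact: scale1r. Qed.
Fact rsecZDr : right_distributive rsecZ +%R.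
Proof. by move=> f s t; apply: section_ext => x; exact: scalerDr. Qed.
Fact rsecZDl s : {morph rsecZ^~ s : f g / f + g}.
Proof. by move=> f g; apply: section_ext => x; exact: scalerDl. Qed.

HB.instance Definition _ := GRing.Zmodule_isLmodule.Build R rsection
  rsecZA rsec1Z rsecZDr rsecZDl.

End Sections.

(* Smooth real vector bundles of constant rank, given by their fibres and a
   smooth trivializing atlas: over the open set [tdom i] the map [tcoord i x]
   identifies the fibre at x with R^r, with inverse [tframe i x]. *)
Record vbundle (R : realType) (n : nat) (M : manifold R n) := VBundle {
  vfib : M -> lmodType R;
  vrank : nat;
  tindex : Type;
  tdom : tindex -> set M;
  tcoord : forall (i : tindex) (x : M), {linear vfib x -> 'rV[R]_vrank};
  tframe : forall (i : tindex) (x : M), {linear 'rV[R]_vrank -> vfib x};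
  tdom_open : forall i, open (tdom i);
  tdom_cover : forall x, exists i, tdom i x;
  tcoordK : forall i x, tdom i x -> cancel (tcoord i x) (tframe i x);
  tframeK : forall i x, tdom i x -> cancel (tframe i x) (tcoord i x);
  ttransition : forall i j (v : 'rV[R]_vrank) (k : 'I_vrank),
    smooth_on (tdom i `&` tdom j) (fun x => tcoord j x (tframe i x v) ord0 k) }.

Section Families.
Variables (R : realType) (n : nat) (M : manifold R n).

Definition vb_smooth_sec (E : vbundle M) (s : forall x, vfib E x) : Prop :=
  forall i (k : 'I_(vrank E)),
    smooth_on (tdom i) (fun x => tcoord i x (s x) ord0 k).

Lemma vb_smooth_sec0 (E : vbundle M) : vb_smooth_sec (fun x => 0 : vfib E x).
Proof.
move=> i k; have -> : (fun x => tcoord i x (0 : vfib E x) ord0 k) = fun=> 0.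
  by apply/funext => x; rewrite linear0 mxE.
exact: smooth_on_cst (@tdom_open _ _ _ E i).
Qed.

Lemma vb_smooth_secP (E : vbundle M) (f : smoothfun M) (s t : forall x, vfib E x) :
  vb_smooth_sec s -> vb_smooth_sec t ->
  vb_smooth_sec (fun x => f x *: s x + t x).
Proof.
move=> ss st i k; have oi := @tdom_open _ _ _ E i.
have -> : (fun x => tcoord i x (f x *: s x + t x) ord0 k) =
    fun x => f x * tcoord i x (s x) ord0 k + tcoord i x (t x) ord0 k.
  by apply/funext => x; rewrite linearP !mxE.
apply: smooth_on_add (st i k) => //; apply: smooth_on_mul (ss i k) => //.
by apply: smooth_onW (smooth_predP _ (sfunP f)).
Qed.

Definition vb_family (E : vbundle M) : vfamily M :=
  Family (@vb_smooth_sec0 E) (@vb_smooth_secP E).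

Definition tm_smooth_sec (X : forall x : M, tangent x) : Prop :=
  forall f : smoothfun M, smooth_on setT (fun x => X x f).

Lemma tm_smooth_sec0 : tm_smooth_sec (fun=> 0).
Proof. by move=> f; exact: smooth_on_cst openT. Qed.

Lemma tm_smooth_secP (f : smoothfun M) (s t : forall x : M, tangent x) :
  tm_smooth_sec s -> tm_smooth_sec t -> tm_smooth_sec (fun x => f x *: s x + t x).
Proof.
move=> ss st g; apply: smooth_on_add (st g) => //; first exact: openT.
apply: smooth_on_mul (ss g) => //; first exact: openT.
exact: smooth_predP _ (sfunP f).
Qed.

(* The tangent bundle; a vector field is a derivation-valued section X such
   that X(f) is smooth for all smooth f. *)
Definition TM : vfamily M := Family tm_smooth_sec0 tm_smooth_secP.

Definition dsum_fib (E F : vfamily M) (x : M) : lmodType R := (E x * F x)%type.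

Definition dsum_smooth_sec (E F : vfamily M) (s : forall x, dsum_fib E F x) :=
  smooth_sec (fun x => (s x).1) /\ smooth_sec (fun x => (s x).2).

Lemma dsum_smooth_sec0 (E F : vfamily M) :
  dsum_smooth_sec (fun x => 0 : dsum_fib E F x).
Proof. by split; exact: smooth_sec0. Qed.

Lemma dsum_smooth_secP (E F : vfamily M) (f : smoothfun M)
    (s t : forall x, dsum_fib E F x) :
  dsum_smooth_sec s -> dsum_smooth_sec t ->
  dsum_smooth_sec (fun x => f x *: s x + t x).
Proof. by move=> [s1 s2] [t1 t2]; split; exact: smooth_secP. Qed.

Definition dsum (E F : vfamily M) : vfamily M :=
  Family (@dsum_smooth_sec0 E F) (@dsum_smooth_secP E F).

End Families.

Coercion vb_family : vbundle >-> vfamily.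

Section VectorFields.
Variables (R : realType) (n : nat) (M : manifold R n).
Implicit Types (X Y : section (TM M)) (f g : smoothfun M).

Definition vact X f : smoothfun M :=
  SmoothFun (introT (smooth_predP _) (secP X f)).

Lemma tangent_lin (x : M) (D : tangent x) (a : R) f g :
  D (smooth_cst M a * f + g) = a * D f + D g.
Proof. by have /asboolP[+ _] := tfunP D. Qed.

Lemma tangentM (x : M) (D : tangent x) f g : D (f * g) = D f * g x + f x * D g.
Proof. by have /asboolP[_ +] := tfunP D. Qed.

Lemma vactD X f g : vact X (f + g) = vact X f + vact X g.
Proof.
apply: smoothfun_ext => x; have := tangent_lin (X x) 1 f g.
have -> : smooth_cst M 1 = 1 by apply: smoothfun_ext.
by rewrite !mul1r.
Qed.

Lemma vact0 X : vact X 0 = 0.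
Proof. by apply: (addIr (vact X 0)); rewrite -vactD !add0r. Qed.

Lemma vactM X f g : vact X (f * g) = vact X f * g + f * vact X g.
Proof. by apply: smoothfun_ext => x; exact: tangentM. Qed.

Lemma vactZ X (a : R) f :
  vact X (smooth_cst M a * f) = smooth_cst M a * vact X f.
Proof.
apply: smoothfun_ext => x; have := tangent_lin (X x) a f 0.
by rewrite -[X x 0]/(vact X 0 x) vact0 !addr0.
Qed.

Definition lie_fun X Y (x : M) (f : smoothfun M) : R :=
  X x (vact Y f) - Y x (vact X f).

Lemma lie_funP X Y x : lie_fun X Y x \in derivation_at x.
Proof.
apply/asboolP; split=> [a f g|f g]; rewrite /lie_fun.
  rewrite !vactD !vactZ !tangent_lin; ring.
rewrite !vactM -[vact Y f * g]mul1r -[vact X f * g]mul1r.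
have <- : smooth_cst M 1 = 1 by apply: smoothfun_ext.
rewrite !tangent_lin !tangentM /=; ring.
Qed.

Lemma lie_smooth X Y : @smooth_sec _ _ _ (TM M) (fun x => Tangent (lie_funP X Y x)).
Proof.
move=> f /=.
have -> : (fun x => lie_fun X Y x f) = vact X (vact Y f) - vact Y (vact X f).
  by [].
exact: smooth_predP _ (sfunP (vact X (vact Y f) - vact Y (vact X f))).
Qed.

Definition lie X Y : section (TM M) := Section_ (lie_smooth X Y).

End VectorFields.

Section BundleMaps.
Variables (R : realType) (n : nat) (M : manifold R n).

Record bmap (E F : vfamily M) := BMap {
  bfib : forall x, {linear E x -> F x};
  bsmooth : forall s : section E, smooth_sec (fun x => bfib x (s x)) }.

Definition bapp (E F : vfamily M) (phi : bmap E F) (s : section E) : section F :=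
  Section_ (bsmooth phi s).

(* Bundle maps from the second exterior power of E to F. *)
Record bmap2 (E F : vfamily M) := BMap2 {
  bfib2 : forall x, E x -> E x -> F x;
  bfib2_linear : forall x u, linear (bfib2 (x := x) u);
  bfib2_skew : forall x u v, bfib2 (x := x) u v = - bfib2 v u;
  bsmooth2 : forall s t : section E, smooth_sec (fun x => bfib2 (s x) (t x)) }.

Definition bapp2 (E F : vfamily M) (phi : bmap2 E F) (s t : section E) : section F :=
  Section_ (bsmooth2 phi s t).

Record sym_form (E : vfamily M) := SymForm {
  sform : forall x, E x -> E x -> R;
  sform_linear : forall x u, linear_for *%R (sform (x := x) u);
  sform_sym : forall x u v, sform (x := x) u v = sform v u;
  sform_smooth : forall s t : section E,
    smooth_on setT (fun x => sform (s x) (t x)) }.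

Definition sform_app (E : vfamily M) (S : sym_form E) (s t : section E) :
  smoothfun M := SmoothFun (introT (smooth_predP _) (sform_smooth S s t)).

Definition nondegenerate (E : vfamily M) (S : sym_form E) : Prop :=
  forall x (u : E x), (forall v, sform S u v = 0) -> u = 0.

Variables (E F : vfamily M) (phi : bmap E F).

Definition ker_pred (x : M) : {pred E x} := [pred u | bfib phi x u == 0].

Lemma ker_submod x : submod_closed (@ker_pred x).
Proof.
split=> [|a u v /eqP u0 /eqP v0]; apply/eqP; first exact: linear0.
by rewrite linearP u0 v0 scaler0 addr0.
Qed.

HB.instance Definition _ (x : M) :=
  GRing.isSubmodClosed.Build R (E x) (@ker_pred x) (ker_submod x).

Record ker_fib (x : M) := KerFib {
  kval :> E x;
  kvalP : kval \in @ker_pred x }.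

HB.instance Definition _ x := [isSub for @kval x].
HB.instance Definition _ x := [Choice of ker_fib x by <:].
HB.instance Definition _ x := [SubChoice_isSubLmodule of ker_fib x by <:].

Definition ker_smooth_sec (s : forall x, ker_fib x) : Prop :=
  smooth_sec (fun x => kval (s x)).

Lemma ker_smooth_sec0 : ker_smooth_sec (fun=> 0).
Proof. exact: smooth_sec0. Qed.

Lemma ker_smooth_secP (f : smoothfun M) (s t : forall x, ker_fib x) :
  ker_smooth_sec s -> ker_smooth_sec t ->
  ker_smooth_sec (fun x => f x *: s x + t x).
Proof. exact: smooth_secP. Qed.

Definition kerb : vfamily M := Family ker_smooth_sec0 ker_smooth_secP.

Definition kincl (u : section kerb) : section E :=
  @Section_ _ _ _ E (fun x => kval (u x)) (secP u).

Lemma kbuild_subproof (s : section E) : bapp phi s = 0 ->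
  forall x, s x \in @ker_pred x.
Proof. by move=> s0 x; apply/eqP; exact: (congr1 (fun t : section F => t x) s0). Qed.

Definition kbuild (s : section E) (s0 : bapp phi s = 0) : section kerb :=
  @Section_ _ _ _ kerb (fun x => KerFib (kbuild_subproof s0 x)) (secP s).

Lemma kbuildK (s : section E) (s0 : bapp phi s = 0) : kincl (kbuild s0) = s.
Proof. exact: section_ext. Qed.

Lemma bapp_kincl (u : section kerb) : bapp phi (kincl u) = 0.
Proof. by apply: section_ext => x; apply/eqP; exact: kvalP. Qed.

End BundleMaps.

Section DirectSumSections.
Variables (R : realType) (n : nat) (M : manifold R n) (E F : vfamily M).

Lemma inl_smooth (s : section E) :
  @smooth_sec _ _ _ (dsum E F) (fun x => (s x, 0) : dsum_fib E F x).
Proof. by split; [exact: secP | exact: smooth_sec0]. Qed.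

Lemma inr_smooth (t : section F) :
  @smooth_sec _ _ _ (dsum E F) (fun x => (0, t x) : dsum_fib E F x).
Proof. by split; [exact: smooth_sec0 | exact: secP]. Qed.

Definition sec_inl (s : section E) : section (dsum E F) := Section_ (inl_smooth s).
Definition sec_inr (t : section F) : section (dsum E F) := Section_ (inr_smooth t).

End DirectSumSections.

(* V1 is the degree -1 part. [l2] is the bracket V0 x V0 -> V0 and [l2m] the bracket
   V0 x V1 -> V1; the bracket l_2(m, x) for m in V1, x in V0 is by definition
   - l2m x m, and the bracket V1 x V1 is zero. *)
Record lie2alg (K : pzRingType) (V1 V0 : lmodType K) := Lie2Alg {
  l1 : {linear V1 -> V0};
  l2 : V0 -> V0 -> V0;
  l2m : V0 -> V1 -> V1;
  l3 : V0 -> V0 -> V0 -> V1;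
  l2_linear : forall x, linear (l2 x);
  l2_skew : forall x y, l2 x y = - l2 y x;
  l2m_linearl : forall m, linear (l2m^~ m);
  l2m_linearr : forall x, linear (l2m x);
  l3_linear : forall x y, linear (l3 x y);
  l3_skew12 : forall x y z, l3 x y z = - l3 y x z;
  l3_skew23 : forall x y z, l3 x y z = - l3 x z y;
  l1_l2m : forall x m, l1 (l2m x m) = l2 x (l1 m);
  l2m_l1 : forall m p, l2m (l1 m) p = - l2m (l1 p) m;
  l1_l3 : forall x y z,
    l1 (l3 x y z) = l2 x (l2 y z) - l2 (l2 x y) z - l2 y (l2 x z);
  l3_l1 : forall x y m,
    l3 x y (l1 m) = l2m x (l2m y m) - l2m (l2 x y) m - l2m y (l2m x m);
  l3_jacobi : forall w x y z,
    l2m w (l3 x y z) - l2m x (l3 w y z) + l2m y (l3 w x z) + - l2m z (l3 w x y)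
    - l3 (l2 w x) y z - l3 x (l2 w y) z - l3 x y (l2 w z)
    + l3 w (l2 x y) z + l3 w y (l2 x z) - l3 w x (l2 y z) = 0 }.

(* [A1] is the bundle in degree -1. *)
Record lie2algebroid (R : realType) (n : nat) (M : manifold R n) := Lie2Algebroid {
  A1 : vbundle M;
  A0 : vbundle M;
  rho : bmap A0 (TM M);
  lalg : lie2alg (rsection A1) (rsection A0);
  br1 : section A1 -> section A0 := l1 lalg;
  br2 : section A0 -> section A0 -> section A0 := l2 lalg;
  br2m : section A0 -> section A1 -> section A1 := l2m lalg;
  br3 : section A0 -> section A0 -> section A0 -> section A1 := l3 lalg;
  br1Z : forall (f : smoothfun M) m, br1 (f *: m) = f *: br1 m;
  br3Z : forall (f : smoothfun M) x y z, br3 x y (f *: z) = f *: br3 x y z;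
  br2_leibniz : forall (f : smoothfun M) x y,
    br2 x (f *: y) = f *: br2 x y + vact (bapp rho x) f *: y;
  br2m_leibniz : forall (f : smoothfun M) x m,
    br2m x (f *: m) = f *: br2m x m + vact (bapp rho x) f *: m }.

Section Lie2Algebroids.
Variables (R : realType) (n : nat) (M : manifold R n) (L : lie2algebroid M).
Implicit Types (f : smoothfun M) (x y z : section (A0 L)) (m p : section (A1 L)).

Definition is_transitive : Prop :=
  forall (a : M) (v : tangent a), exists u : A0 L a, bfib (rho L) a u = v.

Definition anchor_defect x y : section (TM M) :=
  lie (bapp (rho L) x) (bapp (rho L) y) - bapp (rho L) (br2 x y).

Lemma br2D x y z : br2 x (y + z) = br2 x y + br2 x z.
Proof. by have := l2_linear (lalg L) x 1 y z; rewrite !scale1r. Qed.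

Lemma br1_br3 x y z :
  br1 (br3 x y z) = br2 x (br2 y z) - br2 (br2 x y) z - br2 y (br2 x z).
Proof. exact: (l1_l3 (lalg L)). Qed.

Lemma defect_cancel (V : zmodType) (a b c p q t u v : V) :
  a - b - c = a + u + (v + p) - (b + t) - (c + v + (u + q)) -> p - q - t = 0.
Proof.
rewrite !opprD !addrA => e.
suff : a - b - c + (p - q - t) = a - b - c by rewrite -[RHS]addr0 => /addrI.
rewrite [RHS]e [RHS](ACl (1*5*7*(4*10*6)*(2*9)*(3*8))) /=.
by rewrite !subrr !addr0.
Qed.

Lemma vact_defectZ f x y z : vact (anchor_defect x y) f *: z = 0.
Proof.
have := br1_br3 x y (f *: z); rewrite br3Z br1Z br1_br3.
rewrite !(br2_leibniz, br2D).
have -> : vact (anchor_defect x y) f =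
    vact (bapp (rho L) x) (vact (bapp (rho L) y) f)
    - vact (bapp (rho L) y) (vact (bapp (rho L) x) f)
    - vact (bapp (rho L) (br2 x y)) f by exact: smoothfun_ext.
by rewrite !scalerBr => /defect_cancel <-; rewrite !scalerBl.
Qed.

(* Not an axiom here: it follows from the Leibniz rule and the C^oo(M)-linearity
   of l_1 and l_3. *)
Lemma anchor_morph x y :
  bapp (rho L) (br2 x y) = lie (bapp (rho L) x) (bapp (rho L) y).
Proof.
apply/esym/eqP; rewrite -subr_eq0 -[_ - _]/(anchor_defect x y); apply/eqP.
set d := anchor_defect x y.
have d0 f g z : vact d f * vact (bapp (rho L) z) g = 0.
  apply: smoothfun_ext => a.
  have /(congr1 (fun s => vact (bapp (rho L) s) g a)) := vact_defectZ f x y z.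
  by rewrite /= linearZ linear0.
apply: section_ext => a; apply: val_inj; apply/funext => f /=.
have dE : vact d f = vact (bapp (rho L) x) (vact (bapp (rho L) y) f)
    - vact (bapp (rho L) y) (vact (bapp (rho L) x) f)
    - vact (bapp (rho L) (br2 x y)) f by exact: smoothfun_ext.
have : vact d f * vact d f = 0 by rewrite {2}dE !mulrBr !d0 !subr0.
by move=> /(congr1 (fun h : smoothfun M => h a)) /= /eqP; rewrite mulf_eq0 orbb => /eqP.
Qed.

Lemma rho_br2_ker x (u : section (kerb (rho L))) :
  bapp (rho L) (br2 x (kincl u)) = 0.
Proof.
rewrite anchor_morph bapp_kincl; apply: section_ext => a; apply: val_inj.
apply/funext => f; rewrite -[LHS]/(vact (bapp (rho L) x) (vact 0 f) a - 0).
suff -> : vact (0 : section (TM M)) f = 0 by rewrite vact0 subrr.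
exact: smoothfun_ext.
Qed.

Definition br2k x (u : section (kerb (rho L))) : section (kerb (rho L)) :=
  kbuild (rho_br2_ker x u).

End Lie2Algebroids.

(* In [q_l1] the hypotheses say that u and v are l_1(m) and l_1(p), seen as
   sections of ker rho.  They always exist: q_l2 and nondegeneracy make
   x |-> l_2(x, m) C^oo(M)-linear, and then rho l_1 = 0 follows from
   l_1 l_2(x, m) = l_2(x, l_1 m). *)
Record quadratic (R : realType) (n : nat) (M : manifold R n)
    (L : lie2algebroid M) := Quadratic {
  q_transitive : is_transitive L;
  q_form : sym_form (dsum (A1 L) (kerb (rho L)));
  q_nondegenerate : nondegenerate q_form;
  q_degree1 : forall (a : M) (m p : A1 L a),
    sform q_form ((m, 0) : dsum_fib (A1 L) (kerb (rho L)) a) (p, 0) = 0;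
  q_degree0 : forall (a : M) (u v : kerb (rho L) a),
    sform q_form ((0, u) : dsum_fib (A1 L) (kerb (rho L)) a) (0, v) = 0;
  qS := sform_app q_form;
  q_l1 : forall (m p : section (A1 L)) (u v : section (kerb (rho L))),
    kincl u = br1 m -> kincl v = br1 p ->
    qS (sec_inr _ u) (sec_inl _ p) = qS (sec_inl _ m) (sec_inr _ v);
  q_l2 : forall (e : section (A0 L)) (u : section (kerb (rho L)))
      (m : section (A1 L)),
    vact (bapp (rho L) e) (qS (sec_inr _ u) (sec_inl _ m)) =
    qS (sec_inr _ (br2k e u)) (sec_inl _ m)
    + qS (sec_inr _ u) (sec_inl _ (br2m e m));
  q_l3 : forall (e1 e2 : section (A0 L)) (u v : section (kerb (rho L))),
    qS (sec_inl _ (br3 e1 e2 (kincl u))) (sec_inr _ v) =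
    - qS (sec_inl _ (br3 e1 e2 (kincl v))) (sec_inr _ u) }.

Section Forms.
Variables (R : realType) (n : nat) (M : manifold R n).
Local Notation X := (section (TM M)).

Definition cochain (V : Type) (k : nat) : Type := ('I_k -> X) -> V.

Definition subst_arg k (Xs : 'I_k -> X) (i : 'I_k) (Y : X) : 'I_k -> X :=
  fun j => if j == i then Y else Xs j.

(* Differential k-forms, as alternating C^oo(M)-multilinear maps. *)
Definition is_form k (w : cochain (smoothfun M) k) : Prop :=
  (forall Xs i j, i != j -> Xs i = Xs j -> w Xs = 0) /\
  (forall Xs i f Y Z, w (subst_arg Xs i (f *: Y + Z)) =
    f * w (subst_arg Xs i Y) + w (subst_arg Xs i Z)).

(* ([X_i, X_j], X_0, .., X_k) with X_i and X_j omitted *)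
Definition bracket_args k (Xs : 'I_k.+1 -> X) (i j : 'I_k.+1) : 'I_k -> X :=
  fun l => nth 0 (lie (Xs i) (Xs j) ::
    [seq Xs a | a <- enum 'I_k.+1 & (a != i) && (a != j)]) l.

(* Indices start at 0, hence the sign (-1)^i where the 1-based formula has
   (-1)^(i+1). *)
Definition cov_d (V : zmodType) (nabla : X -> V -> V) k (w : cochain V k) :
    cochain V k.+1 := fun Xs =>
  \sum_(i < k.+1) nabla (Xs i) (w (fun l => Xs (lift i l))) *~ (-1) ^+ i
  + \sum_(i < k.+1) \sum_(j < k.+1 | (i < j)%N)
      w (bracket_args Xs i j) *~ (-1) ^+ (i + j).

Definition ext_d k : cochain (smoothfun M) k -> cochain (smoothfun M) k.+1 :=
  @cov_d (smoothfun M) (@vact R n M) k.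

Definition closed_form k (w : cochain (smoothfun M) k) : Prop :=
  is_form w /\ ext_d w = (fun=> 0).

(* The de Rham class of w, as a coset of the exact forms. *)
Definition deRham_class k (w : cochain (smoothfun M) k.+1) :
    set (cochain (smoothfun M) k.+1) :=
  [set w' | closed_form w' /\
    exists eta : cochain (smoothfun M) k,
      is_form eta /\ forall Xs, w' Xs = w Xs + ext_d eta Xs].

End Forms.

Record splitting (R : realType) (n : nat) (M : manifold R n)
    (L : lie2algebroid M) := Splitting {
  sigma : bmap (TM M) (A0 L);
  sigmaK : forall (a : M) (v : tangent a), bfib (rho L) a (bfib sigma a v) = v;
  gamma : bmap2 (TM M) (A1 L) }.

Section Pontryagin.
Variables (R : realType) (n : nat) (M : manifold R n) (L : lie2algebroid M).
Variable s : splitting L.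
Local Notation X := (section (TM M)).

Definition nabla1 (Y : X) (m : section (A1 L)) : section (A1 L) :=
  br2m (bapp (sigma s) Y) m.

Definition gamma_form : cochain M (section (A1 L)) 2 :=
  fun Xs => bapp2 (gamma s) (Xs (inord 0)) (Xs (inord 1)).

Definition curvR (Y Z : X) : section (A0 L) :=
  bapp (sigma s) (lie Y Z) - br2 (bapp (sigma s) Y) (bapp (sigma s) Z)
  - br1 (bapp2 (gamma s) Y Z).

Definition curvI : cochain M (section (A1 L)) 3 := fun Xs =>
  - cov_d nabla1 gamma_form Xs
  - br3 (bapp (sigma s) (Xs (inord 0))) (bapp (sigma s) (Xs (inord 1)))
        (bapp (sigma s) (Xs (inord 2))).

Definition Rgamma0 (Y Z : X) : section (A0 L) :=
  curvR Y Z + br1 (bapp2 (gamma s) Y Z).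

Lemma rho_Rgamma0 (Y Z : X) : bapp (rho L) (Rgamma0 Y Z) = 0.
Proof.
rewrite /Rgamma0 /curvR subrK.
have sK (W : X) : bapp (rho L) (bapp (sigma s) W) = W.
  by apply: section_ext => a; exact: sigmaK.
have bB (t u : section (A0 L)) :
    bapp (rho L) (t - u) = bapp (rho L) t - bapp (rho L) u.
  by apply: section_ext => a; exact: linearB.
by rewrite bB anchor_morph !sK subrr.
Qed.

Definition Rgamma (Y Z : X) : section (kerb (rho L)) := kbuild (rho_Rgamma0 Y Z).

Definition Igamma : cochain M (section (A1 L)) 3 := fun Xs =>
  curvI Xs + cov_d nabla1 gamma_form Xs.

Definition pontryagin_form (Q : quadratic L) : cochain M (smoothfun M) 5 :=
  fun Xs => smooth_cst M (12%:R^-1) * \sum_(tau : 'S_5)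
    qS Q (sec_inr _ (Rgamma (Xs (tau (inord 0))) (Xs (tau (inord 1)))))
         (sec_inl _ (Igamma (fun l : 'I_3 => Xs (tau (inord (2 + l))))))
    *~ (-1) ^+ tau.

End Pontryagin.

(* Main.v *)
Require Import Defs.
From HB Require Import structures.
From mathcomp Require Import all_boot all_order all_fingroup all_algebra.
From mathcomp Require Import all_classical all_reals all_analysis.
From mathcomp Require Import ring.
Import Order.TTheory GRing.Theory Num.Theory.

Set Implicit Arguments.
Unset Strict Implicit.
Unset Printing Implicit Defensive.

Local Open Scope ring_scope.

(** Write R and I for the curvatures R_γ and I_γ of a splitting (σ, γ). The terms
    in γ cancel: R(X, Y) = σ[X, Y] - l2 (σX, σY) and I = - l3 (σ, σ, σ). With the
    covariant derivatives ∇_X = l2 (σX, -) on both bundles, the axioms of a Lie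
    2-algebra say that
    - d R = l1 I, a Bianchi identity, from the axiom on l1 l3 ([bianchi]);
    - d I is the contraction of R with l3 (-, σ, σ), from the fundamental identity
      of l3 ([cov_d_l3s]).
    The form S is ∇-invariant, so d S(R, I) = S(l1 I, I) + S(R, l3 (R, σ, σ)) up to
    constants. The first term is symmetric in the two 3-forms I because l1 is
    S-symmetric, whereas odd forms anticommute; the second is skew in the two
    2-forms R because l3 is S-skew, whereas even forms commute. Both vanish
    ([ext_d_pontryagin_density0]).

    For two splittings with difference τ = σ' - σ, which takes values in the kernel
    of the anchor, let σ_t = σ + t τ. The same identities show that the t-derivative
    of S(R_t, I_t) is, up to a constant, the exterior derivative of S(τ, I_t)
    ([ext_d_transgression], [alt_density_deriv]), so the two forms differ by the
    derivative of the integral of S(τ, I_t) over t in [0, 1]. As S(R_t, I_t) is a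
    polynomial of degree at most 5 in t, Boole's five-point rule computes that
    integral exactly and replaces it by a finite sum ([boole_deriv]).

    Forms are handled before antisymmetrization: S(R, I) is the alternating sum
    [alt] of a multilinear density over all permutations of its arguments, and
    [cov_d_alt] gives the exterior derivative of such a sum as the alternating sum
    of an explicit density with one more argument. Reindexing by a few explicit
    permutations then replaces the calculus of wedge products. *)

(** * Alternating sums over all permutations of the arguments *)

Section Alternation.
Variable T : Type.

Definition alt (V : zmodType) n (F : ('I_n -> T) -> V) (Xs : 'I_n -> T) : V :=
  \sum_(s : 'S_n) F (fun l => Xs (s l)) *~ (-1) ^+ s.

Definition insert_arg n (i : 'I_n) (x : T) (Xs : 'I_n.-1 -> T) : 'I_n -> T :=
  fun k => oapp Xs x (unlift i k).

Lemma insert_arg_id n (i : 'I_n) x Xs : insert_arg i x Xs i = x.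
Proof. by rewrite /insert_arg unlift_none. Qed.

Lemma insert_arg_lift n (i : 'I_n) x Xs k : insert_arg i x Xs (lift i k) = Xs k.
Proof. by rewrite /insert_arg liftK. Qed.

Variable V : zmodType.
Implicit Types (n : nat) (x : V).

Lemma mulrz_signM x (b c : bool) : x *~ (-1) ^+ b *~ (-1) ^+ c = x *~ (-1) ^+ (b (+) c).
Proof. by rewrite -mulrzA -signr_addb. Qed.

Lemma eq_alt n (F G : ('I_n -> T) -> V) Xs :
  (forall Ys, F Ys = G Ys) -> alt F Xs = alt G Xs.
Proof. by move=> FG; apply: eq_bigr => s _; rewrite FG. Qed.

Lemma altD n (F G : ('I_n -> T) -> V) Xs :
  alt (fun Ys => F Ys + G Ys) Xs = alt F Xs + alt G Xs.
Proof. by rewrite -big_split; apply: eq_bigr => s _; rewrite mulrzDl. Qed.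

Lemma alt_morph n (W : zmodType) (f : {additive V -> W}) (F : ('I_n -> T) -> V) Xs :
  f (alt F Xs) = alt (fun Ys => f (F Ys)) Xs.
Proof. by rewrite raddf_sum; apply: eq_bigr => s _; rewrite raddfMz. Qed.

Lemma altN n (F : ('I_n -> T) -> V) Xs :
  alt (fun Ys => - F Ys) Xs = - alt F Xs.
Proof. by rewrite -sumrN; apply: eq_bigr => s _; rewrite mulNrz. Qed.

Lemma altB n (F G : ('I_n -> T) -> V) Xs :
  alt (fun Ys => F Ys - G Ys) Xs = alt F Xs - alt G Xs.
Proof. by rewrite altD altN. Qed.

Lemma altMn n (F : ('I_n -> T) -> V) k Xs :
  alt (fun Ys => F Ys *+ k) Xs = alt F Xs *+ k.
Proof. by rewrite -sumrMnl; apply: eq_bigr => s _; rewrite !pmulrn mulrzAC. Qed.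

Lemma alt_sum n (I : Type) (r : seq I) (F : I -> ('I_n -> T) -> V) Xs :
  alt (fun Ys => \sum_(i <- r) F i Ys) Xs = \sum_(i <- r) alt (F i) Xs.
Proof. by rewrite exchange_big; apply: eq_bigr => s _; rewrite mulrz_suml. Qed.

Lemma altMz n (F : ('I_n -> T) -> V) k Xs :
  alt (fun Ys => F Ys *~ k) Xs = alt F Xs *~ k.
Proof. by rewrite mulrz_suml; apply: eq_bigr => s _; rewrite mulrzAC. Qed.

(** The permutation acts on the slots of [F] here, and on the arguments in
    [alt_args_perm]: the first form renames variables inside an alternating sum,
    the second shows that the sum is alternating. *)
Lemma alt_perm n (r : 'S_n) (F : ('I_n -> T) -> V) Xs :
  alt (fun Ys => F (fun l => Ys (r l))) Xs = alt F Xs *~ (-1) ^+ r.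
Proof.
rewrite /alt [in RHS](reindex_inj (mulgI r)) mulrz_suml.
apply: eq_bigr => s _ /=; rewrite odd_permM mulrz_signM addbC addKb.
by congr (F _ *~ _); apply/funext => l; rewrite permM.
Qed.

Lemma alt_args_perm n (r : 'S_n) (F : ('I_n -> T) -> V) Xs :
  alt F (fun l => Xs (r l)) = alt F Xs *~ (-1) ^+ r.
Proof.
rewrite /alt [in RHS](reindex_inj (mulIg r)) mulrz_suml.
apply: eq_bigr => s _ /=; rewrite odd_permM mulrz_signM addbK.
by congr (F _ *~ _); apply/funext => l; rewrite permM.
Qed.

Lemma alt_repeat n (F : ('I_n -> T) -> V) (Xs : 'I_n -> T) i j :
  i != j -> Xs i = Xs j -> alt F Xs *+ 2 = 0.
Proof.
move=> ij Xij; have := alt_args_perm (tperm i j) F Xs.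
rewrite odd_tperm ij mulrN1z => e; rewrite mulr2n -{1}[alt F Xs]opprK -e.
suff -> : (fun l => Xs (tperm i j l)) = Xs by rewrite addNr.
by apply/funext => l; case: tpermP => // ->.
Qed.

(** A permutation of n+1 letters is the image of one letter together with a
    permutation of the others. *)
Lemma big_perm_lift n (f : 'S_n.+1 -> V) (i : 'I_n.+1) :
  \sum_s f s = \sum_j \sum_t f (lift_perm i j t).
Proof.
rewrite pair_big /= (reindex (fun u : 'I_n.+1 * 'S_n => lift_perm i u.1 u.2)) //=.
apply/onW_bij/inj_card_bij; last first.
  by rewrite card_prod !card_Sn card_ord factS.
move=> [j t] [j' t'] /= e.
have ej : j = j' by move: (congr1 (fun s : 'S_n.+1 => s i) e); rewrite !lift_perm_id.
subst j'; congr (_, _); apply/permP => k.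
move: (congr1 (fun s : 'S_n.+1 => s (lift i k)) e).
by rewrite !lift_perm_lift => /lift_inj.
Qed.

Lemma big_perm_liftV n (f : 'S_n.+1 -> V) (j : 'I_n.+1) :
  \sum_s f s = \sum_i \sum_t f (lift_perm i j t).
Proof.
rewrite (reindex_inj invg_inj) (big_perm_lift _ j); apply: eq_bigr => i _.
by rewrite (reindex_inj invg_inj); apply: eq_bigr => t _; rewrite lift_permV invgK.
Qed.

(** Laplace expansion of an alternating sum along its first slot ([alt_recl]:
    which argument sits there) and along its first argument ([alt_insert]: in
    which slot it sits). *)
Lemma alt_recl n (F : ('I_n.+1 -> T) -> V) Xs : alt F Xs =
  \sum_i alt (fun Ys => F (insert_arg ord0 (Xs i) Ys))
    (fun l => Xs (lift i l)) *~ (-1) ^+ i.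
Proof.
rewrite /alt (big_perm_lift _ ord0); apply: eq_bigr => i _.
rewrite mulrz_suml; apply: eq_bigr => t _.
rewrite odd_lift_perm /= -[(-1) ^+ (i : nat)]signr_odd mulrz_signM addbC.
congr (F _ *~ _); apply/funext => l.
by rewrite /insert_arg; case: unliftP => [l'|] ->; rewrite ?lift_perm_lift ?lift_perm_id.
Qed.

Lemma alt_insert n (F : ('I_n.+1 -> T) -> V) Xs : alt F Xs =
  \sum_l alt (fun Ys => F (insert_arg l (Xs ord0) Ys))
    (fun k => Xs (lift ord0 k)) *~ (-1) ^+ l.
Proof.
rewrite /alt (big_perm_liftV _ ord0); apply: eq_bigr => i _.
rewrite mulrz_suml; apply: eq_bigr => t _.
rewrite odd_lift_perm /= -[(-1) ^+ (i : nat)]signr_odd mulrz_signM addbC addbF.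
congr (F _ *~ _); apply/funext => l.
by rewrite /insert_arg; case: unliftP => [l'|] ->; rewrite ?lift_perm_lift ?lift_perm_id.
Qed.

(** Expanding twice along the first slot visits each pair of indices in both
    orders, and [lift i j] is j+1 exactly when it exceeds i, which costs a sign:
    this is how the pairs i < j with sign (-1)^(i+j) of the exterior derivative
    arise, twice each. *)
Lemma sum_pairs n (f : 'I_n.+2 -> 'I_n.+2 -> V) :
  (forall i j, f j i = - f i j) ->
  \sum_i (\sum_(j < n.+1) f i (lift i j) *~ (-1) ^+ j) *~ (-1) ^+ i =
  - ((\sum_(i < n.+2) \sum_(j < n.+2 | (i < j)%N) f i j *~ (-1) ^+ (i + j)) *+ 2).
Proof.
move=> fskew; pose g i j := f i j *~ (-1) ^+ (i + j).
have gskew i j : g j i = - g i j by rewrite /g fskew addnC mulNrz.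
transitivity (\sum_(i < n.+2) \sum_(j < n.+2 | j != i)
    (if (i < j)%N then - g i j else g i j)).
  apply: eq_bigr => i _; rewrite mulrz_suml.
  pose h j := if j == i then 0 else if (i < j)%N then - g i j else g i j.
  transitivity (\sum_j h j); last first.
    rewrite (bigID (pred1 i)) /= big_pred1_eq {1}/h eqxx add0r.
    by apply: eq_bigr => j /negbTE ji; rewrite /h ji.
  rewrite (bigD1_ord i) //= {1}/h eqxx add0r; apply: eq_bigr => j _.
  rewrite /h /g eq_sym (negbTE (neq_lift _ _)) -mulrzA -exprD addnC /= /bump.
  case: (leqP i j) => ij /=; first by rewrite add1n ltnS ij addnS exprS mulN1r mulrNz opprK.
  by rewrite add0n ltnNge ltnW.
rewrite (eq_bigr (fun i : 'I_n.+2 => \sum_(j < n.+2 | (i < j)%N) - g i j +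
    \sum_(j < n.+2 | (j < i)%N) g i j)); last first.
  move=> i _; rewrite (bigID (fun j : 'I_n.+2 => (i < j)%N)) /=; congr (_ + _).
    by apply: eq_big => [j|j /andP[_ ->] //]; rewrite andbC neq_ltn; case: ltnP; rewrite ?orbT.
  by apply: eq_big => [j|j /andP[_ /negbTE->] //]; rewrite neq_ltn; case: ltngtP.
rewrite big_split /= [X in _ + X](exchange_big_dep predT) //= -big_split /=.
rewrite -sumrMnl -sumrN; apply: eq_bigr => i _.
rewrite -sumrMnl -sumrN -big_split /=; apply: eq_bigr => j _.
by rewrite (gskew i j) mulr2n opprD.
Qed.

Lemma alt_even m (r : 'S_m) (F G : ('I_m -> T) -> V) Xs : ~~ odd_perm r ->
  (forall Ys, F Ys = G (fun l => Ys (r l))) -> alt F Xs = alt G Xs.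
Proof. by move=> /negbTE r0 /eq_alt ->; rewrite alt_perm r0. Qed.

Lemma alt_odd m (r : 'S_m) (F G : ('I_m -> T) -> V) Xs : odd_perm r ->
  (forall Ys, F Ys = G (fun l => Ys (r l))) -> alt F Xs = - alt G Xs.
Proof. by move=> r1 /eq_alt ->; rewrite alt_perm r1 mulrN1z. Qed.

End Alternation.

(** * The exterior derivative of an alternating sum *)

Section Cochains.
Variables (R : realType) (n : nat) (M : manifold R n).
Local Notation X := (section (TM M)).

Lemma lie_skew (Y Z : X) : lie Z Y = - lie Y Z.
Proof.
apply: section_ext => a; apply: val_inj; apply/funext => f /=.
by rewrite !fctE /lie_fun opprB.
Qed.

Lemma enum_lift2 m (i : 'I_m.+2) (j : 'I_m.+1) :
  [seq a <- enum 'I_m.+2 | (a != i) && (a != lift i j)] =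
  [seq lift i (lift j k) | k <- enum 'I_m].
Proof.
apply: (inj_map val_inj).
have srt k : sorted ltn (map val (enum 'I_k)) by rewrite val_enum_ord iota_ltn_sorted.
apply: (irr_sorted_eq ltn_trans ltnn).
- rewrite sorted_map; apply: sorted_filter => [? ? ?|]; first exact: ltn_trans.
  by rewrite -sorted_map.
- have -> : map val [seq lift i (lift j k) | k <- enum 'I_m] =
      map (bump i \o bump j) (map val (enum 'I_m)) by rewrite -!map_comp.
  apply: homo_sorted (srt m) => x y /=.
  by rewrite !(leqW_mono (leq_bump2 _)).
move=> x; apply/mapP/mapP => -[a].
  rewrite mem_filter => /andP[/andP[ai aj] _] ->.
  case: (unliftP i a) ai aj => [b ->|->]; rewrite ?eqxx // (inj_eq lift_inj) => _ bj.
  case: (unliftP j b) bj => [c ->|->]; rewrite ?eqxx // => _.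
  by exists (lift i (lift j c)) => //; apply/mapP; exists c; rewrite ?mem_enum.
move=> /mapP[c _ ->] ->; exists (lift i (lift j c)) => //.
by rewrite mem_filter mem_enum andbT eq_sym neq_lift (inj_eq lift_inj) eq_sym neq_lift.
Qed.

Lemma bracket_args_lift m (Xs : 'I_m.+2 -> X) i (j : 'I_m.+1) :
  bracket_args Xs i (lift i j) =
  insert_arg ord0 (lie (Xs i) (Xs (lift i j))) (fun k => Xs (lift i (lift j k))).
Proof.
apply/funext => l; rewrite /bracket_args.
case: (unliftP ord0 l) => [k|] ->; last by rewrite insert_arg_id.
rewrite insert_arg_lift enum_lift2 -map_comp lift0 /= (nth_map k) ?size_enum_ord //=.
by rewrite nth_ord_enum.
Qed.

Lemma bracket_argsE m (Xs : 'I_m.+2 -> X) i j : bracket_args Xs i j =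
  insert_arg ord0 (lie (Xs i) (Xs j)) (fun k => bracket_args Xs i j (lift ord0 k)).
Proof.
by apply/funext => l; case: (unliftP ord0 l) => [k|] ->; rewrite ?insert_arg_lift ?insert_arg_id.
Qed.

Lemma bracket_argsC m (Xs : 'I_m.+2 -> X) i j : bracket_args Xs j i =
  insert_arg ord0 (- lie (Xs i) (Xs j)) (fun k => bracket_args Xs i j (lift ord0 k)).
Proof.
rewrite [LHS]bracket_argsE lie_skew; congr insert_arg; apply/funext => k.
rewrite /bracket_args lift0 /=; congr (nth _ (map _ _) _).
by apply: eq_filter => a; rewrite andbC.
Qed.

(** The derivative of an alternating sum is again an alternating sum, of an
    explicit expression in the unsymmetrized cochain [p]: [alt_recl] turns the
    sum over i into a sum over all permutations, [sum_pairs] does so for the sum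
    over i < j, and [alt_insert] distributes the bracket over the slots of [p].
    With this formula no sum over permutations is ever expanded. *)
Lemma cov_d_alt (V : zmodType) (nabla : X -> {additive V -> V}) m
    (p : cochain M V m.+1) (Xs : 'I_m.+2 -> X) :
  (forall l Y Ys, p (insert_arg l (- Y) Ys) = - p (insert_arg l Y Ys)) ->
  cov_d nabla (alt p) Xs *+ 2 =
  alt (fun Ys => nabla (Ys ord0) (p (fun l => Ys (lift ord0 l))) *+ 2 -
    \sum_l p (insert_arg l (lie (Ys ord0) (Ys (lift ord0 ord0)))
       (fun k => Ys (lift ord0 (lift ord0 k)))) *~ (-1) ^+ l) Xs.
Proof.
move=> podd; rewrite altB altMn /cov_d mulrnDl; congr (_ *+ 2 + _).
  rewrite [RHS]alt_recl; apply: eq_bigr => i _; rewrite alt_morph.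
  congr (_ *~ _); apply: eq_alt => Ys; rewrite insert_arg_id; congr (nabla _ (p _)).
  by apply/funext => l; rewrite insert_arg_lift.
rewrite -[LHS]opprK -sum_pairs; last first.
  move=> i j; rewrite bracket_argsC [in RHS]bracket_argsE !alt_insert -sumrN.
  apply: eq_bigr => l _; rewrite -mulNrz -altN; congr (_ *~ _).
  have insE Y Ys : (fun k => insert_arg ord0 Y Ys (lift ord0 k)) = Ys.
    by apply/funext => k; rewrite insert_arg_lift.
  by rewrite !insE; apply: eq_alt => Ys; rewrite !insert_arg_id podd.
congr (- _).
rewrite alt_recl; apply: eq_bigr => i _; congr (_ *~ _).
rewrite alt_recl; apply: eq_bigr => j _; congr (_ *~ _).
rewrite bracket_args_lift alt_insert alt_sum; apply: eq_bigr => l _.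
rewrite altMz; congr (_ *~ _).
transitivity (alt (fun Ys => p (insert_arg l (lie (Xs i) (Xs (lift i j))) Ys))
  (fun k => Xs (lift i (lift j k)))).
  by congr alt; apply/funext => k; rewrite ?insert_arg_id ?insert_arg_lift.
apply: eq_alt => Ys; rewrite insert_arg_id !insert_arg_lift insert_arg_id;
  congr (p (insert_arg _ _ _)).
by apply/funext => k; rewrite !insert_arg_lift.
Qed.

Fact vact_is_zmod_morphism (Y : X) : zmod_morphism (vact Y).
Proof.
move=> f g; apply/(addIr (vact Y g)).
by rewrite -vactD !subrK.
Qed.

HB.instance Definition _ (Y : X) := GRing.isZmodMorphism.Build
  (smoothfun M) (smoothfun M) (vact Y) (vact_is_zmod_morphism Y).

Lemma smooth_cstD a b : smooth_cst M (a + b) = smooth_cst M a + smooth_cst M b.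
Proof. exact: smoothfun_ext. Qed.

Lemma smooth_cstM a b : smooth_cst M (a * b) = smooth_cst M a * smooth_cst M b.
Proof. exact: smoothfun_ext. Qed.

Lemma smooth_cstN a : smooth_cst M (- a) = - smooth_cst M a.
Proof. exact: smoothfun_ext. Qed.

Lemma smooth_cst1 : smooth_cst M 1 = 1.
Proof. exact: smoothfun_ext. Qed.

Lemma smoothfunMn (f : smoothfun M) k a : (f *+ k) a = f a *+ k.
Proof. by elim: k => // k IH; rewrite !mulrSr -IH. Qed.

Lemma smoothfunMn_inj k : injective (fun f : smoothfun M => f *+ k.+1).
Proof.
move=> f g /(congr1 (fun h : smoothfun M => h _)) fg; apply: smoothfun_ext => a.
by apply: (pmulrnI (ltn0Sn k)); rewrite -!smoothfunMn fg.
Qed.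

(** The second half of [is_form], for cochains that need not alternate. *)
Definition multilinear k (w : cochain M (smoothfun M) k) := forall Xs i f Y Z,
  w (subst_arg Xs i (f *: Y + Z)) =
  f * w (subst_arg Xs i Y) + w (subst_arg Xs i Z).

Lemma is_form_alt k (w : cochain M (smoothfun M) k) :
  multilinear w -> is_form (alt w).
Proof.
move=> wlin; split=> [Xs i j ij Xij|Xs i f Y Z].
  by apply: (@smoothfunMn_inj 1); rewrite (alt_repeat _ ij Xij) mul0rn.
rewrite mulr_sumr -big_split; apply: eq_bigr => s _ /=.
have substE W : (fun l => subst_arg Xs i W (s l)) =
    subst_arg (fun l => Xs (s l)) ((s^-1)%g i) W.
  by apply/funext => l; rewrite /subst_arg (canF_eq (permK s)).
by rewrite !substE wlin mulrzDl mulrzAr.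
Qed.

Lemma multilinearN k (w : cochain M (smoothfun M) k) Xs i Y : multilinear w ->
  w (subst_arg Xs i (- Y)) = - w (subst_arg Xs i Y).
Proof.
move=> wlin; have w0 : w (subst_arg Xs i 0) = 0.
  by have := wlin Xs i (-1) 0 0; rewrite scaler0 addr0 mulN1r addNr.
by have := wlin Xs i (-1) Y 0; rewrite scaleN1r addr0 w0 addr0 mulN1r.
Qed.

Lemma insert_arg_subst k (i : 'I_k) (Y : X) Ys :
  insert_arg i Y Ys = subst_arg (insert_arg i 0 Ys) i Y.
Proof.
apply/funext => l; rewrite /subst_arg; case: eqP => [->|/eqP]; first exact: insert_arg_id.
by rewrite eq_sym => /unlift_some[l' -> _]; rewrite !insert_arg_lift.
Qed.

Lemma ext_d_alt m (p : cochain M (smoothfun M) m.+1) (Xs : 'I_m.+2 -> X) :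
  multilinear p ->
  ext_d (alt p) Xs *+ 2 =
  alt (fun Ys => vact (Ys ord0) (p (fun l => Ys (lift ord0 l))) *+ 2 -
    \sum_l p (insert_arg l (lie (Ys ord0) (Ys (lift ord0 ord0)))
       (fun k => Ys (lift ord0 (lift ord0 k)))) *~ (-1) ^+ l) Xs.
Proof.
move=> plin; rewrite /ext_d cov_d_alt // => l Y Ys.
by rewrite insert_arg_subst multilinearN // -insert_arg_subst.
Qed.

Lemma is_formD k (v w : cochain M (smoothfun M) k) :
  is_form v -> is_form w -> is_form (fun Xs => v Xs + w Xs).
Proof.
move=> [va vl] [wa wl]; split=> [Xs i j ij Xij|Xs i f Y Z].
  by rewrite (va _ _ _ ij) // (wa _ _ _ ij) // addr0.
by rewrite vl wl; ring.
Qed.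

Lemma is_formZ k a (w : cochain M (smoothfun M) k) :
  is_form w -> is_form (fun Xs => smooth_cst M a * w Xs).
Proof.
move=> [wa wl]; split=> [Xs i j ij Xij|Xs i f Y Z].
  by rewrite (wa _ _ _ ij) // mulr0.
by rewrite wl; ring.
Qed.

Lemma ext_dD k (v w : cochain M (smoothfun M) k) Xs :
  ext_d (fun Xs => v Xs + w Xs) Xs = ext_d v Xs + ext_d w Xs.
Proof.
rewrite /ext_d /cov_d [RHS]addrACA.
congr (_ + _); rewrite -big_split; apply: eq_bigr => i _ /=.
  by rewrite vactD mulrzDl.
by rewrite -big_split; apply: eq_bigr => j _; rewrite mulrzDl.
Qed.

Lemma ext_dZ k a (w : cochain M (smoothfun M) k) Xs :
  ext_d (fun Xs => smooth_cst M a * w Xs) Xs = smooth_cst M a * ext_d w Xs.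
Proof.
rewrite /ext_d /cov_d mulrDr !mulr_sumr; congr (_ + _); apply: eq_bigr => i _ /=.
  by rewrite vactZ mulrzAr.
by rewrite mulr_sumr; apply: eq_bigr => j _; rewrite mulrzAr.
Qed.

End Cochains.

(** * Brackets and pairing on sections *)

Section BundleMapSections.
Variables (R : realType) (n : nat) (M : manifold R n).

Fact bapp_is_linear (E F : vfamily M) (phi : bmap E F) : linear (bapp phi).
Proof. by move=> f s t; apply: section_ext => a; exact: linearP. Qed.

HB.instance Definition _ (E F : vfamily M) (phi : bmap E F) :=
  GRing.isLinear.Build (smoothfun M) (section E) (section F) *:%R (bapp phi)
    (@bapp_is_linear E F phi).

Fact kincl_is_linear (E F : vfamily M) (phi : bmap E F) : linear (@kincl R n M E F phi).
Proof. by move=> f s t; apply: section_ext. Qed.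

HB.instance Definition _ (E F : vfamily M) (phi : bmap E F) :=
  GRing.isLinear.Build (smoothfun M) (section (kerb phi)) (section E) *:%R
    (@kincl R n M E F phi) (@kincl_is_linear E F phi).

Lemma kincl_inj (E F : vfamily M) (phi : bmap E F) : injective (@kincl R n M E F phi).
Proof.
move=> s t st; apply: section_ext => a; apply: val_inj.
exact: (congr1 (fun u : section E => u a) st).
Qed.

Lemma lie_linearr (X : section (TM M)) f Y Z :
  lie X (f *: Y + Z) = f *: lie X Y + vact X f *: Y + lie X Z.
Proof.
apply: section_ext => a; apply: val_inj; apply/funext => g.
rewrite -[LHS]/(lie_fun X (f *: Y + Z) a g) /lie_fun.
have -> : vact (f *: Y + Z) g = f * vact Y g + vact Z g by exact: smoothfun_ext.
rewrite -[X a _]/(vact X _ a) vactD vactM /= !fctE /= /lie_fun /=.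
rewrite /GRing.scale /=; ring.
Qed.

Lemma lie_jacobi (X Y Z : section (TM M)) :
  lie (lie X Y) Z + lie (lie Y Z) X + lie (lie Z X) Y = 0.
Proof.
apply: section_ext => a; apply: val_inj; apply/funext => g.
have lieE (V W : section (TM M)) h : vact (lie V W) h = vact V (vact W h) - vact W (vact V h).
  by exact: smoothfun_ext.
suff e : vact (lie (lie X Y) Z) g + vact (lie (lie Y Z) X) g + vact (lie (lie Z X) Y) g = 0.
  exact: (congr1 (fun h : smoothfun M => h a) e).
by rewrite !lieE !raddfB /=; ring.
Qed.

End BundleMapSections.

Section QuadraticLie2Algebroid.
Variables (R : realType) (n : nat) (M : manifold R n).
Variables (L : lie2algebroid M) (Q : quadratic L).
Local Notation X := (section (TM M)).
Local Notation K := (section (kerb (rho L))).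

Definition pairing (u : K) (m : section (A1 L)) : smoothfun M :=
  qS Q (sec_inr _ u) (sec_inl _ m).

Lemma qS_sym s t : qS Q s t = qS Q t s.
Proof. by apply: smoothfun_ext => a; exact: sform_sym. Qed.

Lemma pairing_linearr u f m p : pairing u (f *: m + p) = f * pairing u m + pairing u p.
Proof.
apply: smoothfun_ext => a /=.
rewrite -[RHS](@sform_linear _ _ _ _ (q_form Q) a
  (sec_inr _ u a) (f a) (sec_inl _ m a) (sec_inl _ p a)).
congr (sform _ _ _); apply: injective_projections => /=; by rewrite ?scaler0 ?addr0.
Qed.

Lemma pairing_linearl m f u v : pairing (f *: u + v) m = f * pairing u m + pairing v m.
Proof.
rewrite /pairing ![qS Q (sec_inr _ _) _]qS_sym; apply: smoothfun_ext => a /=.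
rewrite -[RHS](@sform_linear _ _ _ _ (q_form Q) a
  (sec_inl _ m a) (f a) (sec_inr _ u a) (sec_inr _ v a)).
congr (sform _ _ _); apply: injective_projections => /=; by rewrite ?scaler0 ?addr0.
Qed.

Lemma pairingDr u m p : pairing u (m + p) = pairing u m + pairing u p.
Proof. by rewrite -[m]scale1r pairing_linearr mul1r scale1r. Qed.

Lemma pairingDl m u v : pairing (u + v) m = pairing u m + pairing v m.
Proof. by rewrite -[u]scale1r pairing_linearl mul1r scale1r. Qed.

Lemma pairing0r u : pairing u 0 = 0.
Proof. by apply: (addIr (pairing u 0)); rewrite -pairingDr !add0r. Qed.

Lemma pairing0l m : pairing 0 m = 0.
Proof. by apply: (addIr (pairing 0 m)); rewrite -pairingDl !add0r. Qed.

Lemma pairingZr u f m : pairing u (f *: m) = f * pairing u m.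
Proof. by have := pairing_linearr u f m 0; rewrite !addr0 pairing0r addr0. Qed.

Lemma pairingZl m f u : pairing (f *: u) m = f * pairing u m.
Proof. by have := pairing_linearl m f u 0; rewrite !addr0 pairing0l addr0. Qed.

Lemma pairingNr u m : pairing u (- m) = - pairing u m.
Proof. by rewrite -scaleN1r pairingZr mulN1r. Qed.

Lemma pairingNl m u : pairing (- u) m = - pairing u m.
Proof. by rewrite -scaleN1r pairingZl mulN1r. Qed.

(** The two invariance properties of the form that make the Pontryagin form
    closed: l1 is symmetric, and l3 with two arguments fixed is skew. *)
Lemma pairing_br1 m p u v : kincl u = br1 m -> kincl v = br1 p -> pairing u p = pairing v m.
Proof. by move=> um vp; rewrite /pairing (q_l1 Q um vp) qS_sym. Qed.

Lemma pairing_br3 e1 e2 u v :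
  pairing u (br3 e1 e2 (kincl v)) = - pairing v (br3 e1 e2 (kincl u)).
Proof. by rewrite /pairing ![qS Q (sec_inr _ _) _]qS_sym q_l3. Qed.

Implicit Types (x y z : section (A0 L)) (m : section (A1 L)).

Lemma br2_skew x y : br2 x y = - br2 y x.
Proof. exact: (l2_skew (lalg L)). Qed.

Lemma br20r x : br2 x 0 = 0.
Proof. by apply: (addIr (br2 x 0)); rewrite -br2D !add0r. Qed.

Lemma br2Nr x y : br2 x (- y) = - br2 x y.
Proof. by apply: (addIr (br2 x y)); rewrite -br2D !addNr br20r. Qed.

Lemma br2Dl x y z : br2 (x + y) z = br2 x z + br2 y z.
Proof. by rewrite br2_skew br2D opprD -!(br2_skew _ z). Qed.

Lemma br3_skew12 x y z : br3 x y z = - br3 y x z.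
Proof. exact: (l3_skew12 (lalg L)). Qed.

Lemma br3_skew23 x y z : br3 x y z = - br3 x z y.
Proof. exact: (l3_skew23 (lalg L)). Qed.

Lemma br3_rot x y z : br3 x y z = br3 z x y.
Proof. by rewrite br3_skew23 br3_skew12 opprK. Qed.

Lemma br3_linear3 x y f z t : br3 x y (f *: z + t) = f *: br3 x y z + br3 x y t.
Proof.
rewrite -br3Z; have := l3_linear (lalg L) x y 1 (f *: z) t.
by rewrite !scale1r.
Qed.

Lemma br3_linear2 x z f y t : br3 x (f *: y + t) z = f *: br3 x y z + br3 x t z.
Proof. by rewrite br3_skew23 br3_linear3 opprD -scalerN -!br3_skew23. Qed.

Lemma br3_linear1 y z f x t : br3 (f *: x + t) y z = f *: br3 x y z + br3 t y z.
Proof. by rewrite br3_skew12 br3_linear2 opprD -scalerN -!br3_skew12. Qed.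

End QuadraticLie2Algebroid.

(** * Explicit permutations of numbered arguments *)

Local Notation "Ys ⟨ k ⟩" := (Ys (inord k))
  (at level 2, format "Ys ⟨ k ⟩").

Section Numerals.

Lemma inord_eqE m a b : (a <= m)%N -> (b <= m)%N ->
  (inord a == inord b :> 'I_m.+1) = (a == b).
Proof. by move=> am bm; rewrite -val_eqE /= !inordK. Qed.

Lemma ord0_inord m : ord0 = inord 0 :> 'I_m.+1.
Proof. by apply: val_inj; rewrite /= inordK. Qed.

Lemma lift0_inord m k : (k <= m)%N ->
  lift (inord 0 : 'I_m.+2) (inord k : 'I_m.+1) = inord k.+1.
Proof. by move=> km; apply: val_inj; rewrite /= !inordK // ltnS ltnW. Qed.

Lemma tperm_inord m a b c : (a <= m)%N -> (b <= m)%N -> (c <= m)%N ->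
  tperm (inord a : 'I_m.+1) (inord b) (inord c) =
  inord (if c == a then b else if c == b then a else c).
Proof.
move=> am bm cm; case: (c =P a) => [->|/eqP ca]; first by rewrite tpermL.
case: (c =P b) => [->|/eqP cb]; first by rewrite tpermR.
by rewrite tpermD // inord_eqE // eq_sym.
Qed.

Lemma insert_arg_inord (T : Type) m a b x (Xs : 'I_m.+1 -> T) : (a <= m.+1)%N -> (b <= m.+1)%N ->
  insert_arg (inord a : 'I_m.+2) x Xs (inord b) =
  if b == a then x else Xs (inord (unbump a b)).
Proof.
move=> am bm; rewrite -(inord_eqE bm am); case: eqP => [->|/eqP]; first by rewrite insert_arg_id.
rewrite eq_sym /insert_arg => /unlift_some[k bE ->] /=; congr Xs.
have -> : b = bump a k by move: (congr1 val bE); rewrite /= !inordK.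
by rewrite bumpK inord_val.
Qed.

Lemma subst_arg_inord (R : realType) n (M : manifold R n) m
    (Xs : 'I_m.+1 -> section (TM M)) a b Y : (a <= m)%N -> (b <= m)%N ->
  subst_arg Xs (inord a) Y (inord b) = if b == a then Y else Xs (inord b).
Proof. by move=> am bm; rewrite /subst_arg inord_eqE. Qed.

End Numerals.
(** Checks the sign of an explicit product of transpositions, or that it renames
    the numbered arguments as required. *)
Ltac perm_inord :=
  by [rewrite ?odd_permM !odd_tperm !inord_eqE | move=> ?; rewrite ?permM !tperm_inord].

(** * The Pontryagin form is closed *)

Section Curvature.
Variables (R : realType) (n : nat) (M : manifold R n).
Variables (L : lie2algebroid M) (Q : quadratic L) (s : splitting L).
Local Notation X := (section (TM M)).
Local Notation K := (section (kerb (rho L))).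
Local Notation σ := (bapp (sigma s)).
Implicit Types (Y Z W : X).

Lemma rho_sigma Y : bapp (rho L) (σ Y) = Y.
Proof. by apply: section_ext => a; exact: sigmaK. Qed.

Lemma kincl_Rgamma Y Z : kincl (Rgamma s Y Z) = σ (lie Y Z) - br2 (σ Y) (σ Z).
Proof. by rewrite kbuildK /Rgamma0 /curvR subrK. Qed.

Lemma Rgamma_skew Y Z : Rgamma s Y Z = - Rgamma s Z Y.
Proof.
apply: kincl_inj; rewrite linearN /= !kincl_Rgamma (lie_skew Z) linearN br2_skew /=.
by rewrite opprD opprK.
Qed.

Lemma Rgamma_linearr Y f Z W :
  Rgamma s Y (f *: Z + W) = f *: Rgamma s Y Z + Rgamma s Y W.
Proof.
apply: kincl_inj; rewrite linearP /= !kincl_Rgamma lie_linearr !linearD !linearZ /=.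
rewrite br2D br2_leibniz rho_sigma ?scalerBr ?scalerN.
by rewrite [X in X - _]addrAC [X in _ - X]addrAC opprD addrACA subrr addr0 opprD addrACA.
Qed.

Definition l3s Y Z W := br3 (σ Y) (σ Z) (σ W).

(** The Pontryagin form is -1/12 times the alternating sum of this density; the
    sign is that of I = - l3 (σ, σ, σ), and γ has cancelled out of both R and I. *)
Definition pontryagin_density : cochain M (smoothfun M) 5 := fun Ys =>
  pairing Q (Rgamma s Ys⟨0⟩ Ys⟨1⟩)
         (l3s Ys⟨2⟩ Ys⟨3⟩ Ys⟨4⟩).

Lemma pontryagin_formE Xs : pontryagin_form s Q Xs =
  smooth_cst M (- 12%:R^-1) * alt pontryagin_density Xs.
Proof.
rewrite /pontryagin_form smooth_cstN mulNr -mulrN -altN; congr (_ * _).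
apply: eq_bigr => t _; congr (_ *~ _).
rewrite /Igamma /curvI addrAC addNr add0r -[qS _ _ _]/(pairing Q _ _) pairingNr !inordK //.
Qed.

Lemma pontryagin_density_multilinear : multilinear pontryagin_density.
Proof.
move=> Xs i f Y Z; rewrite -(inord_val i); case: i => [] [|[|[|[|[|//]]]]] _ /=;
  rewrite /pontryagin_density !subst_arg_inord //= /l3s ?linearP.
- by rewrite !(Rgamma_skew _ (Xs _)) Rgamma_linearr pairingNl pairing_linearl !pairingNl; ring.
- by rewrite Rgamma_linearr pairing_linearl.
- by rewrite br3_linear1 pairing_linearr.
- by rewrite br3_linear2 pairing_linearr.
- by rewrite br3_linear3 pairing_linearr.
Qed.

Lemma ext_d_pontryagin_density Xs : ext_d (alt pontryagin_density) Xs *+ 2 =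
  alt (fun Ys =>
    vact Ys⟨0⟩ (pairing Q (Rgamma s Ys⟨1⟩ Ys⟨2⟩)
      (l3s Ys⟨3⟩ Ys⟨4⟩ Ys⟨5⟩)) *+ 2
   - pairing Q (Rgamma s (lie Ys⟨0⟩ Ys⟨1⟩) Ys⟨2⟩)
      (l3s Ys⟨3⟩ Ys⟨4⟩ Ys⟨5⟩) *+ 2
   - pairing Q (Rgamma s Ys⟨2⟩ Ys⟨3⟩)
      (l3s (lie Ys⟨0⟩ Ys⟨1⟩) Ys⟨4⟩ Ys⟨5⟩) *+ 3) Xs.
Proof.
rewrite (ext_d_alt _ pontryagin_density_multilinear); apply: eq_alt => Ys.
rewrite !big_ord_recl big_ord0 /= !ord0_inord !lift0_inord // /pontryagin_density.
rewrite !insert_arg_inord //= !lift0_inord //.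
(* Skew-symmetry of R and l3 moves the bracket to the first slot of its factor;
   the resulting sign cancels that of the insertion, so the two slots of R and
   the three slots of l3 each contribute equal terms. *)
rewrite -![(-1) ^+ bump _ _]signr_odd /bump /unbump /= !subn1 /= !expr0 !expr1.
rewrite !mulrN1z !mulr1z (Rgamma_skew _ (lie _ _)) pairingNl.
rewrite /l3s (br3_skew12 _ (σ (lie _ _))) (br3_rot _ _ (σ (lie _ _))) pairingNr.
ring.
Qed.

Local Notation J := l3s.
Local Notation R_ := (Rgamma s).

Lemma kincl_br2k x (u : K) : kincl (br2k x u) = br2 x (kincl u).
Proof. exact: kbuildK. Qed.

Lemma vact_pairing Y u m : vact Y (pairing Q u m) =
  pairing Q (br2k (σ Y) u) m + pairing Q u (br2m (σ Y) m).
Proof. by rewrite -{1}(rho_sigma Y); exact: q_l2. Qed.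

(** One of the three terms of the cyclic sum that is the covariant exterior
    derivative of R. *)
Definition cov_dR Y Z W : K := br2k (σ Y) (R_ Z W) - R_ (lie Y Z) W.

(** The Bianchi identity d R = l1 I: in the cyclic sum the terms [σ, σ[-, -]]
    cancel in pairs, the terms σ[[-, -], -] vanish by the Jacobi identity for
    vector fields, and the Jacobiator of σ Y, σ Z, σ W is l1 l3. *)
Lemma bianchi Y Z W :
  kincl (cov_dR Y Z W + cov_dR Z W Y + cov_dR W Y Z) = br1 (- l3s Y Z W).
Proof.
have jac : σ (lie (lie Y Z) W) + σ (lie (lie Z W) Y) + σ (lie (lie W Y) Z) = 0.
  by rewrite -!linearD lie_jacobi linear0.
have kE A B C : kincl (cov_dR A B C) = br2 (σ A) (σ (lie B C)) - br2 (σ A) (br2 (σ B) (σ C))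
    - σ (lie (lie A B) C) - br2 (σ C) (σ (lie A B)).
  rewrite linearB /= kincl_br2k !kincl_Rgamma br2D br2Nr -[in RHS]addrA -opprD.
  by rewrite [br2 (σ C) _]br2_skew.
have -> : br1 (- l3s Y Z W) = - br1 (l3s Y Z W).
  exact: (linearN (l1 (lalg L))).
rewrite linearD linearD /= !kE /l3s br1_br3.
rewrite [br2 (br2 _ _) _]br2_skew [br2 (σ Y) (σ W)]br2_skew br2Nr !opprK !addrA.
(* The first three groups cancel, the fourth is the Jacobi identity of vector
   fields, the last is the Jacobiator. *)
rewrite [LHS](ACl ((1*8)*(5*12)*(9*4)*(3*7*11)*(2*10*6))) /=.
by rewrite !subrr !add0r -!opprD jac add0r.
Qed.

(** Additive functionals of functions of four variables that are skew under
    renaming the variables; the alternating sums below are of this kind. *)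
Record skew4 (T : Type) (U V : zmodType) (A : (T -> T -> T -> T -> U) -> V) : Prop := {
  skew4D : forall f g, A (fun a b c d => f a b c d + g a b c d) = A f + A g;
  skew4_12 : forall f, A (fun a b c d => f b a c d) = - A f;
  skew4_23 : forall f, A (fun a b c d => f a c b d) = - A f;
  skew4_34 : forall f, A (fun a b c d => f a b d c) = - A f }.

Lemma skew4_0 (T : Type) (U V : zmodType) (A : (T -> T -> T -> T -> U) -> V) :
  skew4 A -> A (fun _ _ _ _ => 0) = 0.
Proof.
by move=> skA; apply: (addIr (A (fun _ _ _ _ => 0))); rewrite -(skew4D skA) !add0r.
Qed.

Lemma skew4N (T : Type) (U V : zmodType) (A : (T -> T -> T -> T -> U) -> V) f :
  skew4 A -> A (fun a b c d => - f a b c d) = - A f.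
Proof.
move=> skA; apply: (addIr (A f)).
rewrite -(skew4D skA) addNr -[RHS](skew4_0 skA); congr A.
by do 4![apply/funext => ?]; rewrite addNr.
Qed.

(** The fundamental identity of l3, skew-symmetrized: its four terms l2 (w, l3)
    become equal, and so do its six terms l3 (l2 (w, x), y, z), in which
    l2 (σ w, σ x) = σ [w, x] - R (w, x). This is the identity that the covariant
    exterior derivative of l3 (σ, σ, σ) is the contraction of R with l3, seen
    through an arbitrary skew functional. *)
Lemma cov_d_l3s (A : (X -> X -> X -> X -> section (A1 L)) -> smoothfun M) : skew4 A ->
  A (fun w x y z => br2m (σ w) (l3s x y z)) *+ 2 =
  A (fun w x y z => l3s (lie w x) y z) *+ 3 -
  A (fun w x y z => br3 (kincl (R_ w x)) (σ y) (σ z)) *+ 3.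
Proof.
move=> skA; set N := A _; set D := A _; set C := A _.
have s12 := skew4_12 skA; have s23 := skew4_23 skA; have s34 := skew4_34 skA.
pose B := A (fun w x y z => br3 (br2 (σ w) (σ x)) (σ y) (σ z)).
have CE : C = D - B.
  rewrite /B -(skew4N _ skA) /D -(skew4D skA) /C; congr A.
  do 4![apply/funext => ?]; rewrite kincl_Rgamma addrC -scaleN1r br3_linear1.
  by rewrite scaleN1r addrC.
have N2 : A (fun w x y z => br2m (σ x) (l3s w y z)) = - N.
  exact: (s12 (fun w x y z => br2m (σ w) (l3s x y z))).
have N3 : A (fun w x y z => br2m (σ y) (l3s w x z)) = N.
  rewrite -[N]opprK -N2.
  exact: (s23 (fun w x y z => br2m (σ x) (l3s w y z))).
have N4 : A (fun w x y z => br2m (σ z) (l3s w x y)) = - N.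
  rewrite -N3.
  exact: (s34 (fun w x y z => br2m (σ y) (l3s w x z))).
have B2 : A (fun w x y z => br3 (σ x) (br2 (σ w) (σ y)) (σ z)) = B.
  rewrite -[B]opprK -s23 -(skew4N _ skA); congr A.
  by do 4![apply/funext => ?]; rewrite br3_skew12.
have B3 : A (fun w x y z => br3 (σ x) (σ y) (br2 (σ w) (σ z))) = B.
  rewrite -[B]opprK -B2 -s34 -(skew4N _ skA); congr A.
  by do 4![apply/funext => ?]; rewrite br3_skew23.
have B4 : A (fun w x y z => br3 (σ w) (br2 (σ x) (σ y)) (σ z)) = - B.
  by rewrite -B2 -s12.
have B5 : A (fun w x y z => br3 (σ w) (σ y) (br2 (σ x) (σ z))) = - B.
  by rewrite -B3 -s12.
have B6 : A (fun w x y z => br3 (σ w) (σ x) (br2 (σ y) (σ z))) = B.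
  by rewrite -[B]opprK -B5 -s23.
apply: (@smoothfunMn_inj _ _ _ 1).
have : A (fun w x y z =>
    br2m (σ w) (l3s x y z) - br2m (σ x) (l3s w y z) + br2m (σ y) (l3s w x z)
    + - br2m (σ z) (l3s w x y)
    - br3 (br2 (σ w) (σ x)) (σ y) (σ z) - br3 (σ x) (br2 (σ w) (σ y)) (σ z)
    - br3 (σ x) (σ y) (br2 (σ w) (σ z)) + br3 (σ w) (br2 (σ x) (σ y)) (σ z)
    + br3 (σ w) (σ y) (br2 (σ x) (σ z)) - br3 (σ w) (σ x) (br2 (σ y) (σ z))) = 0.
  rewrite -[RHS](skew4_0 skA); congr A; do 4![apply/funext => ?].
  exact: (l3_jacobi (lalg L)).
rewrite !(skew4D skA) !(skew4N _ skA) N2 N3 N4 B2 B3 B4 B5 B6 -/N -/B CE => e.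
by rewrite -[LHS]subr0 -e; ring.
Qed.

Lemma alt6_skew4 Xs (Φ : X -> X -> K) : skew4 (fun f : X -> X -> X -> X -> section (A1 L) =>
  alt (fun Ys : 'I_6 -> X => pairing Q (Φ Ys⟨0⟩ Ys⟨1⟩)
    (f Ys⟨2⟩ Ys⟨3⟩ Ys⟨4⟩ Ys⟨5⟩)) Xs).
Proof.
split=> [f g|f|f|f]; first by rewrite -altD; apply: eq_alt => Ys; rewrite pairingDr.
- apply: (@alt_odd _ _ _ (tperm (inord 2) (inord 3))); perm_inord.
- apply: (@alt_odd _ _ _ (tperm (inord 3) (inord 4))); perm_inord.
- apply: (@alt_odd _ _ _ (tperm (inord 4) (inord 5))); perm_inord.
Qed.

(** By the Leibniz rule the derivative is S(dR, I) + S(R, dI). The Bianchi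
    identity turns the first term into S(l1 I, I), symmetric under exchanging the
    two 3-forms I by [pairing_br1], an odd permutation of the arguments; the
    second becomes S(R, l3 (R, σ, σ)), skew under exchanging the two 2-forms R by
    [pairing_br3], an even permutation. Both vanish. *)
Lemma ext_d_pontryagin_density0 Xs : ext_d (alt pontryagin_density) Xs = 0.
Proof.
apply: (@smoothfunMn_inj _ _ _ 1); rewrite mul0rn ext_d_pontryagin_density.
pose N := alt (fun Ys : 'I_6 -> X => pairing Q (R_ Ys⟨0⟩ Ys⟨1⟩)
  (br2m (σ Ys⟨2⟩) (J Ys⟨3⟩ Ys⟨4⟩ Ys⟨5⟩))) Xs.
pose D := alt (fun Ys : 'I_6 -> X => pairing Q (R_ Ys⟨0⟩ Ys⟨1⟩)
  (J (lie Ys⟨2⟩ Ys⟨3⟩) Ys⟨4⟩ Ys⟨5⟩)) Xs.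
pose C := alt (fun Ys : 'I_6 -> X => pairing Q (R_ Ys⟨0⟩ Ys⟨1⟩)
  (br3 (kincl (R_ Ys⟨2⟩ Ys⟨3⟩)) (σ Ys⟨4⟩) (σ Ys⟨5⟩))) Xs.
pose B := alt (fun Ys : 'I_6 -> X => pairing Q (cov_dR Ys⟨0⟩ Ys⟨1⟩ Ys⟨2⟩)
  (J Ys⟨3⟩ Ys⟨4⟩ Ys⟨5⟩)) Xs.
have NDC : N *+ 2 = D *+ 3 - C *+ 3 := cov_d_l3s (alt6_skew4 Xs R_).
(* Exchange the two curvatures. *)
have C0 : C = 0.
  apply: (@smoothfunMn_inj _ _ _ 1); rewrite mul0rn mulr2n.
  apply/eqP; rewrite addr_eq0 -altN; apply/eqP.
  apply: (@alt_even _ _ _ (tperm (inord 0) (inord 2) * tperm (inord 1) (inord 3))%g).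
    perm_inord.
  move=> Ys; rewrite !permM !tperm_inord //=.
  by rewrite -(br3_rot (σ _) (σ _) (kincl _)) pairing_br3 br3_rot.
(* The three cyclic renamings are even, so -B is a third of the alternating sum of
   S(l1 I, I); exchanging the two triples of arguments is odd. *)
have B0 : B = 0.
  apply: (@smoothfunMn_inj _ _ _ 5); rewrite mul0rn (mulrnA B 3 2).
  have -> : B *+ 3 = alt (fun Ys : 'I_6 -> X =>
      pairing Q (cov_dR Ys⟨0⟩ Ys⟨1⟩ Ys⟨2⟩ +
              cov_dR Ys⟨1⟩ Ys⟨2⟩ Ys⟨0⟩ +
              cov_dR Ys⟨2⟩ Ys⟨0⟩ Ys⟨1⟩)
        (J Ys⟨3⟩ Ys⟨4⟩ Ys⟨5⟩)) Xs.
    under eq_alt do rewrite pairingDl pairingDl.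
    rewrite altD altD mulrS mulr2n addrA; congr (_ + _ + _); apply/esym.
      apply: (@alt_even _ _ _ (tperm (inord 0) (inord 1) * tperm (inord 0) (inord 2))%g);
      perm_inord.
    apply: (@alt_even _ _ _ (tperm (inord 0) (inord 2) * tperm (inord 0) (inord 1))%g);
      perm_inord.
  rewrite mulr2n; apply/eqP; rewrite addr_eq0; apply/eqP.
  apply: (@alt_odd _ _ _ (tperm (inord 0) (inord 3) * tperm (inord 1) (inord 4)
    * tperm (inord 2) (inord 5))%g); first perm_inord.
  move=> Ys; rewrite !permM !tperm_inord //=.
  by apply: oppr_inj; rewrite -!pairingNr; apply: pairing_br1; exact: bianchi.
transitivity (B *+ 2 + N *+ 2 - D *+ 3); last by rewrite B0 NDC C0; ring.
have -> : N = alt (fun Ys : 'I_6 -> X => pairing Q (R_ Ys⟨1⟩ Ys⟨2⟩)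
    (br2m (σ Ys⟨0⟩) (J Ys⟨3⟩ Ys⟨4⟩ Ys⟨5⟩))) Xs.
  apply/esym.
  by apply: (@alt_even _ _ _ (tperm (inord 0) (inord 1) * tperm (inord 0) (inord 2))%g);
    perm_inord.
have -> : D = alt (fun Ys : 'I_6 -> X => pairing Q (R_ Ys⟨2⟩ Ys⟨3⟩)
    (J (lie Ys⟨0⟩ Ys⟨1⟩) Ys⟨4⟩ Ys⟨5⟩)) Xs.
  apply/esym.
  by apply: (@alt_even _ _ _ (tperm (inord 0) (inord 2) * tperm (inord 1) (inord 3))%g);
    perm_inord.
rewrite /B -!altMn -altD -altB; apply: eq_alt => Ys.
by rewrite vact_pairing /cov_dR pairingDl pairingNl; ring.
Qed.

End Curvature.

(** * Infinitesimal variation of the splitting *)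

Section Transgression.
Variables (R : realType) (n : nat) (M : manifold R n).
Variables (L : lie2algebroid M) (Q : quadratic L).
Local Notation X := (section (TM M)).
Local Notation K := (section (kerb (rho L))).
Variables (s : splitting L) (τ : X -> K).
Hypothesis τ_linear : forall f Y Z, τ (f *: Y + Z) = f *: τ Y + τ Z.
Local Notation σ := (bapp (sigma s)).
Local Notation R_ := (Rgamma s).
Local Notation J := (l3s s).

Definition transgression_density : cochain M (smoothfun M) 4 := fun Ys =>
  pairing Q (τ Ys⟨0⟩) (J Ys⟨1⟩ Ys⟨2⟩ Ys⟨3⟩).

(** The covariant exterior derivative of τ, seen as a 1-form with values in the
    kernel of the anchor. *)
Definition cov_d1 (Y Z : X) : K := br2k (σ Y) (τ Z) - br2k (σ Z) (τ Y) - τ (lie Y Z).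

Lemma kincl_cov_d1 Y Z : kincl (cov_d1 Y Z) =
  br2 (σ Y) (kincl (τ Z)) - br2 (σ Z) (kincl (τ Y)) - kincl (τ (lie Y Z)).
Proof. by rewrite !linearB /= !kincl_br2k. Qed.

Lemma transgression_density_multilinear : multilinear transgression_density.
Proof.
move=> Xs i f Y Z; rewrite -(inord_val i); case: i => [] [|[|[|[|//]]]] _ /=;
  rewrite /transgression_density !subst_arg_inord //= /l3s ?linearP.
- by rewrite τ_linear pairing_linearl.
- by rewrite br3_linear1 pairing_linearr.
- by rewrite br3_linear2 pairing_linearr.
- by rewrite br3_linear3 pairing_linearr.
Qed.

Lemma alt5_skew4 Xs : skew4 (fun f : X -> X -> X -> X -> section (A1 L) =>
  alt (fun Ys : 'I_5 -> X => pairing Q (τ Ys⟨0⟩)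
    (f Ys⟨1⟩ Ys⟨2⟩ Ys⟨3⟩ Ys⟨4⟩)) Xs).
Proof.
split=> [f g|f|f|f]; first by rewrite -altD; apply: eq_alt => Ys; rewrite pairingDr.
- apply: (@alt_odd _ _ _ (tperm (inord 1) (inord 2))); perm_inord.
- apply: (@alt_odd _ _ _ (tperm (inord 2) (inord 3))); perm_inord.
- apply: (@alt_odd _ _ _ (tperm (inord 3) (inord 4))); perm_inord.
Qed.

(** By the Leibniz rule the derivative is S(dτ, l3 σσσ) - S(τ, d(l3 σσσ)), the
    last factor is the contraction of R with l3 by [cov_d_l3s], and [pairing_br3]
    exchanges R and τ. The result is minus the derivative of S(R, l3 σσσ) at σ in
    the direction τ: under [alt] the three terms where τ replaces one σ agree. *)
Lemma ext_d_transgression Xs : ext_d (alt transgression_density) Xs *+ 2 =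
  alt (fun Ys : 'I_5 -> X =>
    pairing Q (cov_d1 Ys⟨0⟩ Ys⟨1⟩)
      (J Ys⟨2⟩ Ys⟨3⟩ Ys⟨4⟩)
    - pairing Q (R_ Ys⟨0⟩ Ys⟨1⟩)
        (br3 (kincl (τ Ys⟨2⟩)) (σ Ys⟨3⟩) (σ Ys⟨4⟩)) *+ 3) Xs.
Proof.
rewrite (ext_d_alt _ transgression_density_multilinear).
transitivity (alt (fun Ys : 'I_5 -> X =>
    vact Ys⟨0⟩ (pairing Q (τ Ys⟨1⟩)
      (J Ys⟨2⟩ Ys⟨3⟩ Ys⟨4⟩)) *+ 2
    - pairing Q (τ (lie Ys⟨0⟩ Ys⟨1⟩))
        (J Ys⟨2⟩ Ys⟨3⟩ Ys⟨4⟩)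
    + pairing Q (τ Ys⟨2⟩)
        (J (lie Ys⟨0⟩ Ys⟨1⟩) Ys⟨3⟩ Ys⟨4⟩) *+ 3) Xs).
  apply: eq_alt => Ys.
  rewrite !big_ord_recl big_ord0 /= !ord0_inord !lift0_inord // /transgression_density.
  rewrite !insert_arg_inord //= !lift0_inord //.
  rewrite -![(-1) ^+ bump _ _]signr_odd /bump /unbump /= !subn1 /= !expr0 !expr1.
  rewrite !mulrN1z !mulr1z.
  rewrite /l3s (br3_skew12 _ (σ (lie _ _))) (br3_rot _ _ (σ (lie _ _))) pairingNr.
  ring.
pose A := alt (fun Ys : 'I_5 -> X => pairing Q (br2k (σ Ys⟨0⟩) (τ Ys⟨1⟩))
    (J Ys⟨2⟩ Ys⟨3⟩ Ys⟨4⟩)) Xs.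
pose T := alt (fun Ys : 'I_5 -> X => pairing Q (τ (lie Ys⟨0⟩ Ys⟨1⟩))
    (J Ys⟨2⟩ Ys⟨3⟩ Ys⟨4⟩)) Xs.
pose N := alt (fun Ys : 'I_5 -> X => pairing Q (τ Ys⟨0⟩)
  (br2m (σ Ys⟨1⟩) (J Ys⟨2⟩ Ys⟨3⟩ Ys⟨4⟩))) Xs.
pose D := alt (fun Ys : 'I_5 -> X => pairing Q (τ Ys⟨0⟩)
  (J (lie Ys⟨1⟩ Ys⟨2⟩) Ys⟨3⟩ Ys⟨4⟩)) Xs.
pose C := alt (fun Ys : 'I_5 -> X => pairing Q (τ Ys⟨0⟩)
  (br3 (kincl (R_ Ys⟨1⟩ Ys⟨2⟩)) (σ Ys⟨3⟩) (σ Ys⟨4⟩))) Xs.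
have NDC : N *+ 2 = D *+ 3 - C *+ 3 := cov_d_l3s s (alt5_skew4 Xs).
(* Rename the arguments so that only A, T, N, D and C occur. *)
have A' : alt (fun Ys : 'I_5 -> X => pairing Q (br2k (σ Ys⟨1⟩) (τ Ys⟨0⟩))
    (J Ys⟨2⟩ Ys⟨3⟩ Ys⟨4⟩)) Xs = - A.
  by apply: (@alt_odd _ _ _ (tperm (inord 0) (inord 1))); perm_inord.
have N' : alt (fun Ys : 'I_5 -> X => pairing Q (τ Ys⟨1⟩)
    (br2m (σ Ys⟨0⟩) (J Ys⟨2⟩ Ys⟨3⟩ Ys⟨4⟩))) Xs = - N.
  by apply: (@alt_odd _ _ _ (tperm (inord 0) (inord 1))); perm_inord.
have D' : alt (fun Ys : 'I_5 -> X => pairing Q (τ Ys⟨2⟩)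
    (J (lie Ys⟨0⟩ Ys⟨1⟩) Ys⟨3⟩ Ys⟨4⟩)) Xs = D.
  by apply: (@alt_even _ _ _ (tperm (inord 0) (inord 2) * tperm (inord 0) (inord 1))%g);
    perm_inord.
have C' : alt (fun Ys : 'I_5 -> X => pairing Q (R_ Ys⟨0⟩ Ys⟨1⟩)
    (br3 (kincl (τ Ys⟨2⟩)) (σ Ys⟨3⟩) (σ Ys⟨4⟩))) Xs = - C.
  rewrite -altN.
  apply: (@alt_even _ _ _ (tperm (inord 0) (inord 2) * tperm (inord 0) (inord 1))%g).
    perm_inord.
  move=> Ys; rewrite !permM !tperm_inord //=.
  by rewrite -(br3_rot (σ _) (σ _) (kincl _)) pairing_br3 br3_rot.
transitivity (A *+ 2 - T - N *+ 2 + D *+ 3).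
  transitivity (A *+ 2 - T + (- N) *+ 2 + D *+ 3); last by rewrite mulNrn.
  rewrite -N' -D' /A /T -!altMn -altB -!altD; apply: eq_alt => Ys.
  by rewrite (@vact_pairing _ _ _ _ Q s); ring.
transitivity (A - (- A) - T - (- C) *+ 3); last first.
  rewrite -C' -A' /A /T -!altMn -!altB; apply: eq_alt => Ys.
  by rewrite /cov_d1 !pairingDl !pairingNl; ring.
rewrite NDC; ring.
Qed.

End Transgression.

(** * Polynomial variation along the segment between two splittings *)

Section Interpolation.
Variables (R : realType) (n : nat) (M : manifold R n).
Variables (L : lie2algebroid M) (Q : quadratic L).
Local Notation X := (section (TM M)).
Local Notation K := (section (kerb (rho L))).
Variables (s s' : splitting L).
Local Notation σ := (bapp (sigma s)).

Lemma rho_splitting_diff Y : bapp (rho L) (bapp (sigma s') Y - σ Y) = 0.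
Proof. by rewrite linearB /= !rho_sigma subrr. Qed.

Definition splitting_diff (Y : X) : K := kbuild (rho_splitting_diff Y).
Local Notation τ := splitting_diff.

Lemma splitting_diff_linear f Y Z : τ (f *: Y + Z) = f *: τ Y + τ Z.
Proof.
apply: kincl_inj; rewrite linearP /= !kbuildK !linearP /= scalerBr.
by rewrite scalerN addrACA.
Qed.

Definition interp_fib (t : R) (a : M) : {linear tangent a -> A0 L a} :=
  bfib (sigma s) a \+ t \*: (bfib (sigma s') a \- bfib (sigma s) a).

Lemma interp_smooth t (Y : X) : smooth_sec (fun a => interp_fib t a (Y a)).
Proof. exact: secP (σ Y + smooth_cst M t *: (bapp (sigma s') Y - σ Y)). Qed.

Lemma interpK t (a : M) (v : tangent a) : bfib (rho L) a (interp_fib t a v) = v.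
Proof. by rewrite /= linearD linearZ linearB /= !sigmaK subrr scaler0 addr0. Qed.

(** The Pontryagin form depends on σ alone, so γ is simply kept. *)
Definition interp t : splitting L :=
  @Splitting _ _ _ _ (@BMap _ _ _ (TM M) (A0 L) (interp_fib t) (interp_smooth t))
   (interpK t) (gamma s).

Lemma sigma_interp t Y :
  bapp (sigma (interp t)) Y = smooth_cst M t *: kincl (τ Y) + σ Y.
Proof. by rewrite addrC; apply: section_ext. Qed.

Definition diff_bracket (Y Z : X) : K := br2k (kincl (τ Y)) (τ Z).

(** By the Leibniz rule only constants can be pulled out of l2; this is enough for the
    curvature of [interp t] to be polynomial in t. *)
Lemma br2_cstl t x y : br2 (smooth_cst M t *: x) y = smooth_cst M t *: br2 x y :> section (A0 L).
Proof.
rewrite br2_skew [in RHS]br2_skew scalerN; congr (- _).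
have := l2_linear (lalg L) y t x 0; rewrite !addr0 => e; rewrite [LHS]e.
have := l2_linear (lalg L) y 1 0 0.
by rewrite !scale1r addr0 -[LHS]addr0 => /addrI <-; rewrite addr0.
Qed.

Lemma br2_cstr t x y : br2 x (smooth_cst M t *: y) = smooth_cst M t *: br2 x y :> section (A0 L).
Proof. by rewrite br2_skew br2_cstl -scalerN -br2_skew. Qed.

Lemma cov_d1_interp t Y Z : cov_d1 (interp t) τ Y Z =
  cov_d1 s τ Y Z + smooth_cst M t *: diff_bracket Y Z *+ 2.
Proof.
apply: kincl_inj.
transitivity (kincl (cov_d1 s τ Y Z)
  + smooth_cst M t *: kincl (diff_bracket Y Z) *+ 2); last first.
  by apply: section_ext.
rewrite !kincl_cov_d1 !kincl_br2k !sigma_interp ![_ *: kincl _ + _]addrC.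
move: (kincl (τ Y)) (kincl (τ Z)) (kincl (τ (lie Y Z))) => a b c.
rewrite !br2Dl !br2_cstl (br2_skew b a) scalerN.
by rewrite opprD opprK mulr2n !addrA [LHS](ACl (1*3*5*2*4)).
Qed.

Lemma Rgamma_interp t Y Z : Rgamma (interp t) Y Z =
  Rgamma s Y Z - smooth_cst M t *: cov_d1 s τ Y Z
   - smooth_cst M (t ^+ 2) *: diff_bracket Y Z.
Proof.
apply: kincl_inj.
transitivity (kincl (Rgamma s Y Z) - smooth_cst M t *: kincl (cov_d1 s τ Y Z)
  - smooth_cst M (t ^+ 2) *: kincl (diff_bracket Y Z)); last by apply: section_ext.
rewrite kincl_cov_d1 kincl_br2k !kincl_Rgamma !sigma_interp ![_ *: kincl _ + _]addrC.
move: (kincl (τ Y)) (kincl (τ Z)) (kincl (τ (lie Y Z))) => a b c.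
rewrite br2D !br2Dl !br2_cstl !br2_cstr.
rewrite scalerA -smooth_cstM -expr2 (br2_skew a (σ Z)).
rewrite scalerN !scalerBr !opprD !opprK !addrA.
by rewrite [RHS](ACl (1*5*2*4*3*6)).
Qed.

(** The t-derivative of the Pontryagin density of [interp t]. *)
Definition density_deriv t : cochain M (smoothfun M) 5 := fun Ys =>
  let σt := bapp (sigma (interp t)) in
  let κ Y := kincl (τ Y) in
  pairing Q (Rgamma (interp t) Ys⟨0⟩ Ys⟨1⟩)
    (br3 (κ Ys⟨2⟩) (σt Ys⟨3⟩) (σt Ys⟨4⟩) +
     br3 (σt Ys⟨2⟩) (κ Ys⟨3⟩) (σt Ys⟨4⟩) +
     br3 (σt Ys⟨2⟩) (σt Ys⟨3⟩) (κ Ys⟨4⟩))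
  - pairing Q (cov_d1 (interp t) τ Ys⟨0⟩ Ys⟨1⟩)
      (l3s (interp t) Ys⟨2⟩ Ys⟨3⟩ Ys⟨4⟩).

Lemma alt_density_deriv t Xs : alt (density_deriv t) Xs =
  - (ext_d (alt (transgression_density Q (interp t) τ)) Xs *+ 2).
Proof.
rewrite (ext_d_transgression _ _ splitting_diff_linear) -altN.
pose C := alt (fun Ys : 'I_5 -> X =>
  pairing Q (Rgamma (interp t) Ys⟨0⟩ Ys⟨1⟩)
    (br3 (kincl (τ Ys⟨2⟩)) (bapp (sigma (interp t)) Ys⟨3⟩)
      (bapp (sigma (interp t)) Ys⟨4⟩))) Xs.
pose D := alt (fun Ys : 'I_5 -> X =>
  pairing Q (cov_d1 (interp t) τ Ys⟨0⟩ Ys⟨1⟩)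
      (l3s (interp t) Ys⟨2⟩ Ys⟨3⟩ Ys⟨4⟩)) Xs.
have C2 : alt (fun Ys : 'I_5 -> X =>
    pairing Q (Rgamma (interp t) Ys⟨0⟩ Ys⟨1⟩)
      (br3 (bapp (sigma (interp t)) Ys⟨2⟩) (kincl (τ Ys⟨3⟩))
        (bapp (sigma (interp t)) Ys⟨4⟩))) Xs = C.
  rewrite -[RHS]opprK -[X in - X]altN.
  apply: (@alt_odd _ _ _ (tperm (inord 2) (inord 3))); first perm_inord.
  by move=> Ys; rewrite !tperm_inord //= br3_skew12 pairingNr.
have C3 : alt (fun Ys : 'I_5 -> X =>
    pairing Q (Rgamma (interp t) Ys⟨0⟩ Ys⟨1⟩)
      (br3 (bapp (sigma (interp t)) Ys⟨2⟩)
        (bapp (sigma (interp t)) Ys⟨3⟩) (kincl (τ Ys⟨4⟩)))) Xs = C.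
  rewrite -C2 -[RHS]opprK -[X in - X]altN.
  apply: (@alt_odd _ _ _ (tperm (inord 3) (inord 4))); first perm_inord.
  by move=> Ys; rewrite !tperm_inord //= br3_skew23 pairingNr.
transitivity (C + C + C - D).
  rewrite -{2}C2 -{2}C3 /C /D -!altD -altB; apply: eq_alt => Ys.
  by rewrite /density_deriv /= !pairingDr.
transitivity (C *+ 3 - D); first by ring.
by rewrite /C /D -altMn -altB; apply: eq_alt => Ys; ring.
Qed.

End Interpolation.

(** * Integration of polynomials by Boole's rule *)

Section Boole.
Variables (R : realType) (n : nat) (M : manifold R n).

(** Boole's quadrature rule on [0, 1], which is exact for polynomials of degree
    at most 5. It stands for the transgression integral over t, and being a
    finite sum it commutes with the exterior derivative. *)
Definition boole (F : R -> smoothfun M) : smoothfun M :=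
  smooth_cst M (7 / 90) * F 0 + smooth_cst M (32 / 90) * F (1 / 4)
  + smooth_cst M (12 / 90) * F (1 / 2) + smooth_cst M (32 / 90) * F (3 / 4)
  + smooth_cst M (7 / 90) * F 1.

(** Degree 5 suffices: the Pontryagin density is quadratic in σ through R and cubic
    through l3. *)
Lemma boole_deriv (F dF : R -> smoothfun M) (c0 c1 c2 c3 c4 c5 : smoothfun M) :
  (forall t, let T := smooth_cst M t in
     F t = c0 + T * c1 + T ^+ 2 * c2 + T ^+ 3 * c3 + T ^+ 4 * c4 + T ^+ 5 * c5) ->
  (forall t, let T := smooth_cst M t in dF t = c1 + T * c2 *+ 2 + T ^+ 2 * c3 *+ 3
     + T ^+ 3 * c4 *+ 4 + T ^+ 4 * c5 *+ 5) ->
  F 1 - F 0 = boole dF.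
Proof.
move=> FE dFE; rewrite /boole !FE !dFE; apply: smoothfun_ext => a.
(* At the point a the powers of a constant function compute to iterated products. *)
rewrite -[LHS]/((c0 a + 1 * c1 a + 1 * 1 * c2 a + 1 * (1 * 1) * c3 a
  + 1 * (1 * (1 * 1)) * c4 a + 1 * (1 * (1 * (1 * 1))) * c5 a) - (c0 a + 0 * c1 a
  + 0 * 0 * c2 a + 0 * (0 * 0) * c3 a
  + 0 * (0 * (0 * 0)) * c4 a + 0 * (0 * (0 * (0 * 0))) * c5 a)).
pose q t := c1 a + t * c2 a * 2 + t ^+ 2 * c3 a * 3 + t ^+ 3 * c4 a * 4 + t ^+ 4 * c5 a * 5.
have qE t : (c1 + smooth_cst M t * c2 *+ 2 + smooth_cst M t ^+ 2 * c3 *+ 3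
     + smooth_cst M t ^+ 3 * c4 *+ 4 + smooth_cst M t ^+ 4 * c5 *+ 5) a = q t.
  rewrite /q !mulr_natr; reflexivity.
transitivity (7 / 90 * q 0 + 32 / 90 * q (1 / 4) + 12 / 90 * q (1 / 2)
  + 32 / 90 * q (3 / 4) + 7 / 90 * q 1); first by rewrite /q; field.
by rewrite -!qE.
Qed.

Lemma alt_boole k (F : R -> cochain M (smoothfun M) k) Xs :
  alt (fun Ys => boole (fun t => F t Ys)) Xs = boole (fun t => alt (F t) Xs).
Proof.
have altZ a (G : cochain M (smoothfun M) k) : alt (fun Ys => a * G Ys) Xs = a * alt G Xs.
  by rewrite mulr_sumr; apply: eq_bigr => t _; rewrite mulrzAr.
by rewrite !altD !altZ.
Qed.

Lemma booleMl f (F : R -> smoothfun M) : boole (fun t => f * F t) = f * boole F.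
Proof. by rewrite /boole; ring. Qed.

Lemma ext_d_boole k (F : R -> cochain M (smoothfun M) k) Xs :
  ext_d (fun Ys => boole (fun t => F t Ys)) Xs = boole (fun t => ext_d (F t) Xs).
Proof. by rewrite !ext_dD !ext_dZ. Qed.

Lemma is_form_boole k (F : R -> cochain M (smoothfun M) k) :
  (forall t, is_form (F t)) -> is_form (fun Ys => boole (fun t => F t Ys)).
Proof. by move=> FF; do ![apply: is_formD]; apply: is_formZ. Qed.

End Boole.

(** * Independence of the splitting *)

Section Comparison.
Variables (R : realType) (n : nat) (M : manifold R n).
Variables (L : lie2algebroid M) (Q : quadratic L).
Variables (s s' : splitting L).

(** Along the segment R becomes R - t dτ - t^2 l2 (τ, τ), and l3 (σ, σ, σ) expands
    into eight terms; collecting powers of t exhibits the polynomial and its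
    derivative. *)
Lemma pontryagin_density_interp Ys :
  pontryagin_density Q (interp s s' 1) Ys - pontryagin_density Q (interp s s' 0) Ys =
  boole (fun t => density_deriv Q s s' t Ys).
Proof.
pose κ l := kincl (splitting_diff s s' Ys⟨l⟩).
pose σ l := bapp (sigma s) Ys⟨l⟩.
pose m0 := br3 (σ 2%N) (σ 3%N) (σ 4%N).
pose m1 := br3 (κ 2%N) (σ 3%N) (σ 4%N) + br3 (σ 2%N) (κ 3%N) (σ 4%N)
  + br3 (σ 2%N) (σ 3%N) (κ 4%N).
pose m2 := br3 (κ 2%N) (κ 3%N) (σ 4%N) + br3 (κ 2%N) (σ 3%N) (κ 4%N)
  + br3 (σ 2%N) (κ 3%N) (κ 4%N).
pose m3 := br3 (κ 2%N) (κ 3%N) (κ 4%N).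
pose u0 := Rgamma s Ys⟨0⟩ Ys⟨1⟩.
pose u1 := cov_d1 s (splitting_diff s s') Ys⟨0⟩ Ys⟨1⟩.
pose u2 := diff_bracket s s' Ys⟨0⟩ Ys⟨1⟩.
apply: (boole_deriv (F := fun t => pontryagin_density Q (interp s s' t) Ys)
  (c0 := pairing Q u0 m0) (c1 := pairing Q u0 m1 - pairing Q u1 m0)
  (c2 := pairing Q u0 m2 - pairing Q u1 m1 - pairing Q u2 m0)
  (c3 := pairing Q u0 m3 - pairing Q u1 m2 - pairing Q u2 m1)
  (c4 := - pairing Q u1 m3 - pairing Q u2 m2) (c5 := - pairing Q u2 m3)) => t T.
- rewrite /pontryagin_density Rgamma_interp -/u0 -/u1 -/u2 /l3s !sigma_interp.
  rewrite -![bapp (sigma s) _]/(σ _) -![kincl _]/(κ _).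
  rewrite expr2 smooth_cstM -/T !(br3_linear1, br3_linear2, br3_linear3).
  rewrite !(pairingDl, pairingNl, pairingZl) !pairing_linearr /m0 /m1 /m2 /m3 !pairingDr.
  by ring.
- rewrite /density_deriv Rgamma_interp cov_d1_interp -/u0 -/u1 -/u2 /l3s !sigma_interp.
  rewrite -![bapp (sigma s) _]/(σ _) -![kincl _]/(κ _).
  rewrite mulr2n expr2 smooth_cstM -/T !(br3_linear1, br3_linear2, br3_linear3).
  rewrite !(pairingDl, pairingNl, pairingZl) !(pairingDr, pairingZr).
  rewrite /m0 /m1 /m2 /m3 ?pairingDr.
  by ring.
Qed.

(** The factor is 1/6 = (-1/12) (-2): the first is that of [pontryagin_formE], the
    second that of [alt_density_deriv]. *)
Definition pontryagin_primitive : cochain M (smoothfun M) 4 := fun Xs =>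
  smooth_cst M (1 / 6) * boole (fun t =>
    alt (transgression_density Q (interp s s' t) (splitting_diff s s')) Xs).

Lemma pontryagin_primitive_form : is_form pontryagin_primitive.
Proof.
apply: is_formZ; apply: is_form_boole => t; apply: is_form_alt.
exact/transgression_density_multilinear/splitting_diff_linear.
Qed.

Lemma eq_pontryagin_density (s1 s2 : splitting L) Ys :
  (forall Y, bapp (sigma s1) Y = bapp (sigma s2) Y) ->
  pontryagin_density Q s1 Ys = pontryagin_density Q s2 Ys.
Proof.
move=> e; rewrite /pontryagin_density /l3s !e; congr pairing.
by apply: kincl_inj; rewrite !kincl_Rgamma !e.
Qed.

Lemma pontryagin_form_diff Xs :
  pontryagin_form s' Q Xs = pontryagin_form s Q Xs + ext_d pontryagin_primitive Xs.
Proof.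
have E1 Ys : pontryagin_density Q s' Ys = pontryagin_density Q (interp s s' 1) Ys.
  apply: eq_pontryagin_density => Y; rewrite sigma_interp smooth_cst1 scale1r.
  by rewrite kbuildK subrK.
have E0 Ys : pontryagin_density Q s Ys = pontryagin_density Q (interp s s' 0) Ys.
  apply: eq_pontryagin_density => Y; rewrite sigma_interp.
  by apply: section_ext => a /=; rewrite scale0r add0r.
rewrite !pontryagin_formE; apply/eqP; rewrite addrC -subr_eq -mulrBr -altB; apply/eqP.
under eq_alt do rewrite E1 E0 pontryagin_density_interp.
rewrite alt_boole /pontryagin_primitive ext_dZ ext_d_boole.
have -> : (fun t => alt (density_deriv Q s s' t) Xs) = fun t => smooth_cst M (- 2) *
    ext_d (alt (transgression_density Q (interp s s' t) (splitting_diff s s'))) Xs.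
  apply/funext => t; rewrite alt_density_deriv smooth_cstN smooth_cstD smooth_cst1.
  by rewrite mulNr mulrDl mul1r.
rewrite booleMl mulrA -smooth_cstM.
by congr (smooth_cst M _ * _); field.
Qed.

End Comparison.

Theorem theorem4p3 (R : realType) (n : nat) (M : manifold R n)
    (L : lie2algebroid M) (Q : quadratic L) :
  (forall s : splitting L, closed_form (pontryagin_form s Q)) /\
  (forall s s' : splitting L,
    deRham_class (pontryagin_form s Q) = deRham_class (pontryagin_form s' Q)).
Proof.
have sub (s s' : splitting L) :
    (deRham_class (pontryagin_form s' Q) `<=` deRham_class (pontryagin_form s Q))%classic.
  move=> w [wc [eta [etaf etaE]]]; split=> //.
  exists (fun Xs => eta Xs + pontryagin_primitive Q s s' Xs); split.
    exact/is_formD/pontryagin_primitive_form.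
  by move=> Xs; rewrite etaE (@pontryagin_form_diff _ _ _ _ Q s s') ext_dD
    -addrA [_ + ext_d eta Xs]addrC.
split=> [s|s s']; last by apply/seteqP; split; apply: sub.
have -> : pontryagin_form s Q = fun Xs =>
    smooth_cst M (- 12%:R^-1) * alt (pontryagin_density Q s) Xs.
  by apply/funext => Xs; rewrite pontryagin_formE.
split; first exact/is_formZ/is_form_alt/pontryagin_density_multilinear.
by apply/funext => Xs; rewrite ext_dZ ext_d_pontryagin_density0 mulr0.
Qed.
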